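(* Suppose the body force $\mathbf{g}$ is conservative, i.e. $\mathbf{g}=-\nabla\varphi$ for some scalar field $\varphi$ in $\Omega$, and let $(\mathbf{w},\mathbf{u},q)$ be a sufficiently smooth solution of the GePUP-E formulation (described in the context). Then the kinetic energy $E_{\mathrm{kinetic}}(t)=\frac12\|\mathbf{u}(t)\|^2=\frac12\int_\Omega\mathbf{u}\cdot\mathbf{u}\,\mathrm{d}V$ evolves according to $$\frac{\mathrm{d}}{\mathrm{d}t}E_{\mathrm{kinetic}}=-\nu\|\nabla\mathbf{u}\|^2:=-\nu\sum_{i=1}^{D}\sum_{j=1}^{D}\int_\Omega\left|\frac{\partial u_i}{\partial x_j}\right|^2\mathrm{d}V.$$
   Context: $\Omega\subset\mathbb{R}^D$ is a bounded connected open set with sufficiently smooth boundary, unit outward normal $\mathbf{n}$ and unit tangent vector(s) $\boldsymbol{\tau}$ on $\partial\Omega$. $\nu>0$ is the kinematic viscosity, $\lambda\ge 0$ a penalty parameter. The Leray–Helmholtz projection $\mathscr{P}$ maps a $C^1$ vector field $\mathbf{v}^*$ to $\mathbf{v}^*-\nabla\phi$ where $\Delta\phi=\nabla\cdot\mathbf{v}^*$ in $\Omega$ and $\mathbf{n}\cdot\nabla\phi=\mathbf{n}\cdot\mathbf{v}^*$ on $\partial\Omega$. The GePUP-E formulation is the system for $(\mathbf{w},\mathbf{u},q)$: $\partial_t\mathbf{w}=\mathbf{g}-\mathbf{u}\cdot\nabla\mathbf{u}-\nabla q+\nu\Delta\mathbf{w}$ in $\Omega$; $\mathbf{w}\cdot\boldsymbol{\tau}=0$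 and $\nabla\cdot\mathbf{w}=0$ on $\partial\Omega$; $\mathbf{u}=\mathscr{P}\mathbf{w}$ in $\Omega$, $\mathbf{u}\cdot\mathbf{n}=0$ on $\partial\Omega$; $\Delta q=\nabla\cdot(\mathbf{g}-\mathbf{u}\cdot\nabla\mathbf{u})$ in $\Omega$; $\mathbf{n}\cdot\nabla q=\mathbf{n}\cdot(\mathbf{g}-\mathbf{u}\cdot\nabla\mathbf{u}+\nu\Delta\mathbf{w})+\lambda\,\mathbf{n}\cdot\mathbf{w}$ on $\partial\Omega$; with initial condition $\mathbf{w}(\mathbf{x},t_0)=\mathbf{u}(\mathbf{x},t_0)$ for all $\mathbf{x}\in\overline{\Omega}$. *)

(* Defs.v *)
From HB Require Import structures.
From mathcomp Require Import all_boot all_order all_algebra.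
From mathcomp Require Import all_classical all_reals all_analysis.
Set Implicit Arguments. Unset Strict Implicit. Unset Printing Implicit Defensive.
Import Order.TTheory GRing.Theory Num.Theory.
Import numFieldNormedType.Exports.
Local Open Scope classical_set_scope.
Local Open Scope ring_scope.

Section Defs.
Variable R : realType.

Fixpoint Ck_on {V : normedModType R} (k : nat) (U : set V) (f : V -> R) : Prop :=
  match k with
  | 0 => forall x, U x -> {for x, continuous f}
  | k'.+1 => (forall x, U x -> differentiable f x) /\
             (forall v : V, Ck_on k' U (fun y => 'D_v f y))
  end.

Definition smooth_on {V : normedModType R} (U : set V) (f : V -> R) : Prop :=
  forall k, Ck_on k U f.

Variable D : nat.
Notation vec := 'rV[R]_D.

Definition ev (j : 'I_D) : vec := delta_mx 0 j.

Definition pd {W : normedModType R} (j : 'I_D) (f : vec -> W) (x : vec) : W :=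
  'D_(ev j) f x.

Definition dot (a b : vec) : R := \sum_(i < D) a 0 i * b 0 i.

Definition grad (f : vec -> R) (x : vec) : vec := \row_(j < D) pd j f x.

Definition div (F : vec -> vec) (x : vec) : R := \sum_(j < D) (pd j F x) 0 j.

Definition lap {W : normedModType R} (F : vec -> W) (x : vec) : W :=
  \sum_(j < D) pd j (pd j F) x.

Definition adv (u : vec -> vec) (x : vec) : vec :=
  \sum_(j < D) (u x 0 j) *: pd j u x.

Definition bdry (A : set vec) : set vec := closure A `\` interior A.

(* Omega is a bounded connected open set with C^infty boundary, given by a
   global defining function rho: Omega = {rho < 0}, grad rho <> 0 on {rho = 0}. *)
Definition smooth_bounded_domain (Omega : set vec) (rho : vec -> R) : Prop :=
  [/\ open Omega, bounded_set Omega, connected Omega &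
      [/\ smooth_on setT rho,
           Omega = [set x | rho x < 0] &
           forall x, rho x = 0 -> grad rho x != 0]].

Definition normal (rho : vec -> R) (x : vec) : vec :=
  (Num.sqrt (dot (grad rho x) (grad rho x)))^-1 *: grad rho x.

End Defs.

(* Lebesgue integral over R^n, as the iterated one-dimensional Lebesgue
   integral (Fubini); used only for continuous integrands supported in a
   bounded set. *)
Fixpoint intRn {R : realType} (n : nat) : ('rV[R]_n -> R) -> R :=
  match n with
  | 0 => fun f => f 0
  | n'.+1 => fun f =>
      Rintegral (@lebesgue_measure R) setT
        (fun a : R => intRn (fun y : 'rV[R]_n' => f (row_mx (a%:M : 'rV[R]_1) y)))
  end.

Definition intOmega {R : realType} {D : nat} (Omega : set 'rV[R]_D)
  (f : 'rV[R]_D -> R) : R := intRn (fun x => \1_Omega x * f x).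

(* Main.v *)
(** On [closure Omega] the solution satisfies [w = u], and [u] vanishes on the
    boundary. Indeed the divergence of [w] solves the heat equation with zero
    initial and Dirichlet data, hence vanishes by its own energy estimate; the
    momentum equation, continued to the boundary, combines with the Neumann
    condition on [q] to give [(n . w)' = - lambda (n . w)], so that [n . w = 0];
    and then the potential [phi] of [w - u] is harmonic with zero Neumann data,
    so [grad phi = 0]. The energy identity follows by differentiating under the
    integral sign and integrating by parts.

    No surface integral is needed: all the vector fields [F] that occur have a
    flux [F . grad rho] vanishing on the boundary, hence [O(|rho|)] in [Omega],
    and [int div F = 0] follows by multiplying [F] by cutoffs of [- k rho].
    These cutoffs also reduce [intOmega] to iterated integrals of continuous
    compactly supported functions, where measurability is not an issue. *)
Require Import Defs.
From HB Require Import structures.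
From mathcomp Require Import all_boot all_order all_algebra.
From mathcomp Require Import all_classical all_reals all_analysis.
From mathcomp Require Import measurable_realfun lra ring.
Set Implicit Arguments. Unset Strict Implicit. Unset Printing Implicit Defensive.
Import Order.TTheory GRing.Theory Num.Theory.
Import numFieldNormedType.Exports.
Local Open Scope classical_set_scope.
Local Open Scope ring_scope.

(** * Compactly supported functions on the line *)

Section OneDim.
Variable R : realType.
Local Notation mu := (@lebesgue_measure R).

(** Two features of the hypotheses shape the argument. The equations hold only in the open domain,
    but the fields are smooth on an open neighbourhood of the closed space-time cylinder; identities
    therefore pass to the boundary by continuity, and time derivatives at [t0] and [T] are
    two-sided. On the other hand the potential [phi] is given at each time separately, without
    regularity in time, and [varphi] is only differentiable inside [Omega]. So the time derivative
    of [u] is not computed from the projection but taken over from [w] once the two agree, and the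
    boundedness of [varphi] has to be deduced from that of its gradient [- g].

    The heat equation for [div w] is the divergence of the momentum equation: by the Poisson
    equation, the divergence of [g - u . grad u] cancels the Laplacian of [q]. In the energy balance
    [u] is divergence free and zero on the boundary, which makes the force, pressure and advection
    terms integrate to zero, so that only the viscous term is left. *)

Definition vanishes_off (M : R) (G : R -> R) := forall a, M < `|a| -> G a = 0.

Lemma vanishes_offE (M : R) (G : R -> R) :
  vanishes_off M G -> G \_ `[- M, M] = G.
Proof.
move=> sG; apply/funext => a; rewrite patchE.
case: ifPn => //; rewrite notin_setE/= in_itv/= -ler_norml => /negP.
by rewrite -ltNge => /sG.
Qed.

Lemma bounded_supp_integrable (M C : R) (G : R -> R) :
  measurable_fun setT G -> vanishes_off M G -> (forall a, `|G a| <= C) ->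
  mu.-integrable setT (EFin \o G).
Proof.
move=> mG sG bG; rewrite -(vanishes_offE sG) -restrict_EFin.
have mI : measurable (`[- M, M]%classic : set (measurableTypeR R)) by exact: measurable_itv.
apply/(@integrable_mkcond _ _ _ mu `[- M, M] (EFin \o G) mI).
apply: measurable_bounded_integrable => //.
- exact/compact_finite_measure/segment_compact.
- exact: measurable_funTS.
- exists C; split; first by rewrite num_real.
  by move=> x Cx y _ /=; exact: le_trans (bG y) (ltW Cx).
Qed.

Lemma cont_supp_bounded (M : R) (G : R -> R) : continuous G ->
  vanishes_off M G -> exists C, forall a, `|G a| <= C.
Proof.
move=> cG sG; have [M0|M0] := ltP M 0.
  by exists 0 => a; rewrite sG ?normr0// (lt_le_trans M0).
have [||c _ hc] := @EVT_max R (fun a => `|G a|) (- M) M.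
- by rewrite (@le_trans _ _ 0)// oppr_le0.
- by apply: continuous_subspaceT => x; apply: cvg_norm; exact: cG.
exists `|G c| => a; have [aM|Ma] := leP `|a| M.
  by apply: hc; rewrite in_itv/= -ler_norml.
by rewrite (sG _ Ma) normr0.
Qed.

Lemma cont_supp_integrable (M : R) (G : R -> R) : continuous G ->
  vanishes_off M G -> mu.-integrable setT (EFin \o G).
Proof.
move=> cG sG; have [C bG] := cont_supp_bounded cG sG.
apply: (bounded_supp_integrable _ sG bG); exact: continuous_measurable_fun.
Qed.

Lemma Rintegral_supp_bound (M C : R) (G : R -> R) : 0 <= M ->
  measurable_fun setT G -> vanishes_off M G ->
  (forall a, `|G a| <= C) -> `|\int[mu]_a G a| <= C * (2 * M).
Proof.
move=> M0 mG sG bG.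
have iG : mu.-integrable setT (EFin \o G) by exact: bounded_supp_integrable sG bG.
rewrite -(vanishes_offE sG) -Rintegral_mkcond.
have iG' : mu.-integrable `[-M, M] (EFin \o G).
  by apply: integrableS iG => //; exact: measurable_itv.
apply: le_trans (le_normr_Rintegral _ iG') _; first exact: measurable_itv.
apply: le_trans (_ : \int[mu]_(t in `[-M, M]) C <= _).
  apply: le_Rintegral => //; first exact: integrable_norm.
  apply: measurable_bounded_integrable => //.
    exact/compact_finite_measure/segment_compact.
  exists `|C|; split; first by rewrite num_real.
  by move=> x Cx y _ /=; exact: ltW.
rewrite Rintegral_cst; last exact: measurable_itv.
have C0 : 0 <= C by exact: le_trans (bG 0).
rewrite (_ : fine _ = fine (lebesgue_measure (`[- M, M]%classic : set R)))//.
rewrite lebesgue_measure_itv/= lte_fin.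
case: ifP => _ /=; last by rewrite mulr0 mulr_ge0 ?mulr_ge0.
by rewrite opprK (mulrDl 1 1) mul1r.
Qed.

Lemma Rintegral_dominated (M C : R) (Gk : nat -> R -> R) (G : R -> R) :
  (forall k, continuous (Gk k)) -> (forall k, vanishes_off M (Gk k)) ->
  (forall k a, `|Gk k a| <= C) -> (forall a, Gk ^~ a @ \oo --> G a) ->
  (fun k => \int[mu]_a Gk k a) @ \oo --> \int[mu]_a G a.
Proof.
move=> cGk sGk bGk cvG.
have mGk k : measurable_fun setT (Gk k) by exact: continuous_measurable_fun.
have mG : measurable_fun setT G.
  by apply: (measurable_fun_cvg (h := Gk)) => // a _; exact: cvG.
have sG : vanishes_off M G.
  move=> a Ma; rewrite -(cvg_lim _ (cvG a))//.
  have -> : Gk ^~ a = fun=> 0 by apply/funext => k; exact: sGk.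
  exact: lim_cst.
have bG a : `|G a| <= C.
  by apply: (cvgr_to_le (cvg_norm (cvG a))); exact: nearW.
have iG := bounded_supp_integrable mG sG bG.
have C0 : 0 <= C by exact: le_trans (bG 0).
have ig : mu.-integrable setT (EFin \o (cst C \_ `[-M, M])).
  apply: (@bounded_supp_integrable M C).
  - apply/measurable_restrict => //; exact: measurable_cst.
  - move=> a Ma; rewrite patchE; case: ifPn => //; rewrite inE/= in_itv/= -ler_norml.
    by rewrite leNgt Ma.
  - by move=> a; rewrite patchE; case: ifPn => _ /=; rewrite ?normr0// ger0_norm.
have [| | | | |_ _ h] := @dominated_convergence _ _ _ mu setT measurableT
   (fun k a => (Gk k a)%:E) (EFin \o G) (EFin \o (cst C \_ `[-M, M])) => //.
- by move=> k; apply: (iffRL (measurable_EFinP _ _)); exact: mGk.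
- by apply: (iffRL (measurable_EFinP _ _)).
- by apply: aeW => a _; apply: cvg_EFin => //; [exact: nearW| exact: cvG].
- apply: aeW => a k _ /=; rewrite lee_fin patchE; case: ifPn => //.
  rewrite notin_setE/= in_itv/= -ler_norml => /negP.
  by rewrite -ltNge => /sGk ->; rewrite normr0.
rewrite /Rintegral; apply: fine_cvg; rewrite fineK; last exact: integrable_fin_num.
exact: h.
Qed.

Lemma Rintegral_translate (M h : R) (G : R -> R) : continuous G ->
  vanishes_off M G -> \int[mu]_a G (a + h) = \int[mu]_a G a.
Proof.
move=> cG sG.
(* [K] is so large that [[-K, K]] contains the support of the translate and [[-K + h, K + h]] that
   of [G]; the substitution [x + h] then relates two integrals over bounded intervals. *)
pose K := `|M| + `|h|.
have K0 : 0 <= K by rewrite addr_ge0.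
have sG1 : vanishes_off K (fun a => G (a + h)).
  move=> a Ka; apply: sG; apply: le_lt_trans (ler_norm M) _.
  have := ler_normB (a + h) h; rewrite addrK => ?.
  by rewrite -(ltrD2r `|h|); apply: lt_le_trans Ka _.
have sub (a : R) : a \notin `[- K + h, K + h] -> G a = 0.
  move=> Ka; apply: sG; apply: le_lt_trans (ler_norm M) _.
  rewrite ltNge; apply: contra Ka => aM; rewrite in_itv/=.
  move: aM; rewrite ler_norml => /andP[]; rewrite /K.
  have := ler_norm h; have := ler_norm (-h); rewrite normrN; set x := `|h|; set y := `|M|.
  lra.
rewrite -(vanishes_offE sG1) -Rintegral_mkcond.
have -> : \int[mu]_a G a = \int[mu]_(a in `[- K + h, K + h]) G a.
  rewrite [RHS]Rintegral_mkcond; congr (Rintegral _ _ _); apply/funext => a.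
  by rewrite patchE; case: ifPn => //; rewrite notin_setE/= => /negP /sub.
have dF : derive1 (fun x : R => x + h) = cst 1.
  apply/funext => x; rewrite derive1E.
  exact: (congr1 (fun F : R -> R => F x) (derive_shift 1 h)).
rewrite /Rintegral; congr fine.
rewrite (@integration_by_substitution_increasing R (fun x => x + h) G (-K) K).
- by apply: eq_integral => x _ /=; rewrite dF/= mulr1.
- by rewrite (@le_trans _ _ 0)// oppr_le0.
- by move=> x y _ _ /=; rewrite ltrD2r.
- by rewrite dF => x _; exact: cst_continuous.
- by rewrite dF; exact: is_cvg_cst.
- by rewrite dF; exact: is_cvg_cst.
- have cF : continuous (fun x : R => x + h).
    by move=> x; apply: cvgD; [exact: cvg_id|exact: cvg_cst].
  split.
  + by move=> x _; exact: (ex_derive (is_derive := is_derive_shift x 1 h)).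
  + by apply: cvg_at_right_filter; exact: cF.
  + by apply: cvg_at_left_filter; exact: cF.
- exact: continuous_subspaceT.
Qed.
End OneDim.

(** * The iterated integral of compactly supported functions *)

Section Lines.
Variables (R : realType) (V : normedModType R).
Implicit Types (f : V -> R) (x v : V).

(** The difference quotient of the restriction to a line is that of the directional derivative;
    one-variable results thereby apply along lines. *)
Lemma derivable_line_growth f x v (s : R) :
  (fun h => h^-1 *: (f (x + (h *: (1 : R) + s) *: v) - f (x + s *: v))) =
  (fun h => h^-1 *: (f (h *: v + (x + s *: v)) - f (x + s *: v))).
Proof.
apply/funext => h; congr (_ *: (f _ - _)).
by rewrite scalerDl -scalerA scale1r addrCA.
Qed.

Lemma is_derive_line f x v (s : R) : derivable f (x + s *: v) v ->
  is_derive s 1 (fun s' : R => f (x + s' *: v)) ('D_v f (x + s *: v)).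
Proof.
move=> df; split.
  by rewrite /derivable [X in cvg (X @ _)]derivable_line_growth.
by rewrite /derive [X in lim (X @ _)]derivable_line_growth.
Qed.

Lemma is_derive_of_line f x v d :
  is_derive (0 : R) 1 (fun s : R => f (x + s *: v)) d -> is_derive x v f d.
Proof.
have := derivable_line_growth f x v 0; rewrite scale0r addr0 => e [].
rewrite /derivable /derive /= scale0r addr0 e => cv <-.
by split.
Qed.

Lemma MVT_line f x v (b : R) : 0 <= b ->
  (forall s, 0 <= s <= b -> derivable f (x + s *: v) v) ->
  exists2 s, 0 <= s <= b & f (x + b *: v) - f x = 'D_v f (x + s *: v) * b.
Proof.
move=> b0 df.
have dl s : 0 <= s <= b ->
    is_derive s (1 : R) (fun s' : R => f (x + s' *: v)) ('D_v f (x + s *: v)).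
  by move=> /df; exact: is_derive_line.
have [| |s sb e] := @MVT_segment R (fun s => f (x + s *: v))
  (fun s => 'D_v f (x + s *: v)) 0 b b0.
- by move=> s; rewrite in_itv/= => /andP[s0 sb]; apply: dl; rewrite !ltW.
- apply: derivable_within_continuous => s; rewrite in_itv/= => sb.
  by case: (dl s sb).
- exists s; first by move: sb; rewrite in_itv/=.
  by move: e; rewrite scale0r addr0 subr0.
Qed.
End Lines.

(** * Bounds, linearity, limits and translation invariance of the iterated integral *)

Section IntRn.
Variable R : realType.

Definition cons_rV n (a : R) (y : 'rV[R]_n) : 'rV[R]_n.+1 :=
  row_mx (a%:M : 'rV_1) y.

Lemma cons_rVD n a b (y z : 'rV[R]_n) :
  cons_rV (a + b) (y + z) = cons_rV a y + cons_rV b z.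
Proof. by rewrite /cons_rV raddfD -add_row_mx. Qed.

Lemma cons_rVB n a b (y z : 'rV[R]_n) :
  cons_rV (a - b) (y - z) = cons_rV a y - cons_rV b z.
Proof. by rewrite /cons_rV raddfB -add_row_mx -opp_row_mx. Qed.

Lemma cons_rV_surj n (v : 'rV[R]_n.+1) :
  v = cons_rV (v 0 0) (\row_i v 0 (lift ord0 i)).
Proof.
apply/rowP => i; rewrite /cons_rV mxE; case: splitP => j ij.
  rewrite ord1 mxE eqxx mulr1n; congr (v 0 _); apply/val_inj => /=.
  by rewrite ij ord1.
by rewrite mxE; congr (v 0 _); apply/val_inj; rewrite /= ij.
Qed.

Lemma norm_rV_ge n (v : 'rV[R]_n) i : `|v 0 i| <= `|v|.
Proof.
by rewrite [leRHS]/Num.Def.normr/= mx_normrE (le_bigmax _ _ (ord0, i)).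
Qed.

Lemma norm_rV_le n (v : 'rV[R]_n) (e : R) :
  0 <= e -> (forall i, `|v 0 i| <= e) -> `|v| <= e.
Proof.
move=> e0 ve; rewrite [leLHS]/Num.Def.normr/= mx_normrE.
by apply: bigmax_le => //= -[i j] _; rewrite ord1.
Qed.

Lemma norm_cons_rV n a (y : 'rV[R]_n) :
  `|cons_rV a y| = Num.max `|a| `|y|.
Proof.
apply/eqP; rewrite eq_le; apply/andP; split.
  apply: norm_rV_le => [|i]; first by rewrite le_max normr_ge0.
  rewrite /cons_rV mxE; case: splitP => j _.
    by rewrite ord1 mxE eqxx mulr1n le_max lexx.
  by rewrite le_max norm_rV_ge orbT.
rewrite ge_max; apply/andP; split.
  have := norm_rV_ge (cons_rV a y) 0; rewrite /cons_rV mxE.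
  by case: splitP => // j _; rewrite ord1 mxE eqxx mulr1n.
apply: norm_rV_le => // i.
have := norm_rV_ge (cons_rV a y) (lift ord0 i); rewrite /cons_rV mxE.
case: splitP => j /=; first by rewrite ord1.
by rewrite /bump/= !add1n => -[/val_inj ->].
Qed.

Lemma cons_rV_continuous n : continuous (fun p : R * 'rV[R]_n => cons_rV p.1 p.2).
Proof.
move=> [a y]; apply/cvgrPdist_lt => e e0 /=.
have : \forall p \near (a, y), `|a - p.1| < e /\ `|y - p.2| < e.
  exists (ball a e, ball y e) => /=; first by split; exact: nbhsx_ballx.
  by move=> [a' y'] [/=]; rewrite -!ball_normE.
apply: filterS => -[a' y'] /= [ha hy].
by rewrite -cons_rVB norm_cons_rV gt_max ha.
Qed.

(** The radius [M] is explicit because the bound [C * (2 * M) ^+ n] and dominated convergence need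
    one support common to a whole family. *)
Definition cont_supp n (M : R) (f : 'rV[R]_n -> R) :=
  continuous f /\ forall x, M < `|x| -> f x = 0.

Lemma cont_suppW n (M M' : R) (f : 'rV[R]_n -> R) : M <= M' ->
  cont_supp M f -> cont_supp M' f.
Proof. by move=> MM' [cf sf]; split => // x /(le_lt_trans MM') /sf. Qed.

Lemma cont_supp_lin n (M c : R) (f g : 'rV[R]_n -> R) :
  cont_supp M f -> cont_supp M g -> cont_supp M (fun x => c * f x + g x).
Proof.
move=> [cf sf] [cg sg]; split=> [x|x Mx]; last by rewrite sf// sg// mulr0 addr0.
exact: (cvgD (cvgM (cvg_cst c) (cf x)) (cg x)).
Qed.

Lemma cont_supp_slice n (M : R) (f : 'rV[R]_n.+1 -> R) a :
  cont_supp M f -> cont_supp M (fun y => f (cons_rV a y)).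
Proof.
move=> [cf sf]; split=> [y|y My]; last first.
  by apply: sf; rewrite norm_cons_rV lt_max My orbT.
apply: (@continuous_comp _ _ _ (fun y => cons_rV a y) f); last exact: cf.
apply: (@continuous_comp _ _ _ (fun y => (a, y)) (fun p => cons_rV p.1 p.2)).
  by apply: (@cvg_pair _ _ _ (nbhs y) (nbhs a) (nbhs y)); [exact: cvg_cst|exact: cvg_id].
exact: cons_rV_continuous.
Qed.

(** Predicates on the dimension, proved by a joint induction: measurability of a slice integral
    comes from its continuity, and that continuity uses both the bound and the linearity one
    dimension lower. *)
Definition intRn_bounded n := forall (M C : R) (f : 'rV[R]_n -> R), 0 <= M ->
  cont_supp M f -> (forall x, `|f x| <= C) -> `|intRn f| <= C * (2 * M) ^+ n.

Definition intRn_linear n := forall (M c : R) (f g : 'rV[R]_n -> R), 0 <= M ->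
  cont_supp M f -> cont_supp M g ->
  intRn (fun x => c * f x + g x) = c * intRn f + intRn g.

Lemma intRn_slice_supp n (M : R) (f : 'rV[R]_n.+1 -> R) : intRn_bounded n ->
  0 <= M -> cont_supp M f ->
  vanishes_off M (fun a => intRn (fun y => f (cons_rV a y))).
Proof.
move=> bn M0 cf a Ma; apply/eqP; rewrite -normr_le0.
rewrite -(mul0r ((2 * M) ^+ n)); apply: bn => //; first exact: cont_supp_slice.
by move=> y; rewrite (proj2 cf) ?normr0// norm_cons_rV lt_max Ma.
Qed.

(** By compactness of the ball of radius [M], the slices at [a] converge uniformly to the slice at
    [a0]; linearity makes the difference of the integrals the integral of a uniformly small
    function. *)
Lemma intRn_slice_continuous n (M : R) (f : 'rV[R]_n.+1 -> R) :
  intRn_bounded n -> intRn_linear n -> 0 <= M -> cont_supp M f ->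
  continuous (fun a => intRn (fun y => f (cons_rV a y))).
Proof.
move=> bn ln M0 cf a0; apply/cvgrPdist_le => e e0.
(* The summand 1 keeps the denominator positive when [M = 0]. *)
pose K := (2 * M) ^+ n + 1.
have K0 : 0 < K by rewrite ltr_wpDl// exprn_ge0// mulr_ge0.
have eK : 0 < e / K by rewrite divr_gt0.
have cK : compact [set y : 'rV[R]_n | `|y| <= M].
  apply: bounded_closed_compact.
    exists M; split; first by rewrite num_real.
    by move=> x Mx y /= /le_trans; apply; exact: ltW.
  apply: (@closed_comp _ _ (fun y : 'rV[R]_n => `|y|) [set r | r <= M]).
    by move=> y _; exact: norm_continuous.
  exact: closed_le.
have /compact_near_coveringP/(_ _ (nbhs a0)
  (fun a y => `|f (cons_rV a0 y) - f (cons_rV a y)| <= e / K) _) cov := cK.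
have {}cov : \forall a \near a0, forall y, `|y| <= M ->
    `|f (cons_rV a0 y) - f (cons_rV a y)| <= e / K.
  apply: cov => y _.
  have : (fun p : 'rV[R]_n * R => `|f (cons_rV a0 p.1) - f (cons_rV p.2 p.1)|)
      @ (y, a0) --> `|f (cons_rV a0 y) - f (cons_rV a0 y)|.
    apply: cvg_norm; apply: cvgB.
      apply: (cvg_comp (fst : 'rV[R]_n * R -> 'rV[R]_n) (fun y => f (cons_rV a0 y)) _
        (proj1 (cont_supp_slice a0 cf) y)).
      exact: (@cvg_fst _ _ (nbhs y) (nbhs a0)).
    have cc : cons_rV p.2 p.1 @[p --> (y, a0)] --> cons_rV a0 y.
      apply: (cvg_comp (fun p : 'rV[R]_n * R => (p.2, p.1))
        (fun p => cons_rV p.1 p.2) _ (@cons_rV_continuous n (a0, y))).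
      apply: (@cvg_pair _ _ _ (nbhs (y, a0)) (nbhs a0) (nbhs y)).
        exact: (@cvg_snd _ _ (nbhs y) (nbhs a0)).
      exact: (@cvg_fst _ _ (nbhs y) (nbhs a0)).
    exact: (cvg_comp _ _ cc (proj1 cf (cons_rV a0 y))).
  rewrite subrr normr0 => /cvgr_le; exact.
apply: filterS cov => a cov.
have -> : intRn (fun y => f (cons_rV a0 y)) - intRn (fun y => f (cons_rV a y)) =
    intRn (fun y => (-1) * f (cons_rV a y) + f (cons_rV a0 y)).
  rewrite (ln M)//; [by rewrite mulN1r addrC|exact: cont_supp_slice..].
apply: le_trans (bn M (e / K) _ M0 _ _) _.
- by apply: cont_supp_lin; exact: cont_supp_slice.
- move=> y; rewrite mulN1r addrC; have [/cov//|yM] := leP `|y| M.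
  by rewrite !(proj2 cf) ?subrr ?normr0 ?ltW// norm_cons_rV lt_max yM orbT.
- by rewrite mulrAC ler_pdivrMr// ler_pM2l// lerDl.
Qed.

Lemma intRn_bounded_linear n : intRn_bounded n /\ intRn_linear n.
Proof.
elim: n => [|n [bn ln]].
  by split=> [M C f _ _ bf|M c f g _ _ _] /=; rewrite ?expr0 ?mulr1.
split=> [M C f M0 cf bf|M c f g M0 cf cg] /=.
  rewrite exprSr mulrA; apply: Rintegral_supp_bound => //.
  - apply: continuous_measurable_fun.
    exact: intRn_slice_continuous bn ln M0 cf.
  - exact: intRn_slice_supp bn M0 cf.
  - by move=> a; apply: bn => //; exact: cont_supp_slice.
have ifn (h : 'rV[R]_n.+1 -> R) (ch : cont_supp M h) := cont_supp_integrable
  (intRn_slice_continuous bn ln M0 ch) (intRn_slice_supp bn M0 ch).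
under eq_Rintegral => a _.
  rewrite (ln M)//; [|exact: cont_supp_slice..].
  over.
rewrite RintegralD//.
- by rewrite RintegralZl//; exact: ifn.
- have := integrableZl measurableT c (ifn _ cf).
  by apply: eq_integrable => // x _ /=; rewrite EFinM.
- exact: ifn.
Qed.

Lemma intRn_le n (M C : R) (f : 'rV[R]_n -> R) : 0 <= M ->
  cont_supp M f -> (forall x, `|f x| <= C) -> `|intRn f| <= C * (2 * M) ^+ n.
Proof. by case: (intRn_bounded_linear n) => + _; apply. Qed.

Lemma intRn_lin n (M c : R) (f g : 'rV[R]_n -> R) : 0 <= M ->
  cont_supp M f -> cont_supp M g ->
  intRn (fun x => c * f x + g x) = c * intRn f + intRn g.
Proof. by case: (intRn_bounded_linear n) => _; apply. Qed.

Lemma intRn_slice n (M : R) (f : 'rV[R]_n.+1 -> R) : 0 <= M -> cont_supp M f ->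
  continuous (fun a => intRn (fun y => f (cons_rV a y))) /\
  vanishes_off M (fun a => intRn (fun y => f (cons_rV a y))).
Proof.
have [bn ln] := intRn_bounded_linear n.
move=> M0 cf; split; [exact: intRn_slice_continuous bn ln M0 cf|].
exact: intRn_slice_supp bn M0 cf.
Qed.

(** Continuity is asked of the approximants only, so that the limit may be the discontinuous
    integrand of [intOmega]. *)
Lemma intRn_dominated n (M C : R) (fk : nat -> 'rV[R]_n -> R) f : 0 <= M ->
  (forall k, cont_supp M (fk k)) -> (forall k x, `|fk k x| <= C) ->
  (forall x, fk ^~ x @ \oo --> f x) ->
  (fun k => intRn (fk k)) @ \oo --> intRn f.
Proof.
elim: n M C fk f => [|n IH] M C fk f M0 cf bf lf /=; first exact: lf.
apply: (@Rintegral_dominated _ M (C * (2 * M) ^+ n)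
  (fun k a => intRn (fun y => fk k (cons_rV a y)))).
- by move=> k; exact: (proj1 (intRn_slice M0 (cf k))).
- by move=> k; exact: (proj2 (intRn_slice M0 (cf k))).
- by move=> k a; apply: intRn_le => //; exact: cont_supp_slice.
- move=> a; apply: (IH M C) => // k; exact: cont_supp_slice.
Qed.

Lemma intRn_ge0 n (f : 'rV[R]_n -> R) : (forall x, 0 <= f x) -> 0 <= intRn f.
Proof.
elim: n f => [|n IH] f f0 /=; first exact: f0.
by apply: Rintegral_ge0 => a _; exact: IH.
Qed.

Lemma cont_supp_translate n (M : R) (f : 'rV[R]_n -> R) v :
  cont_supp M f -> cont_supp (M + `|v|) (fun x => f (x + v)).
Proof.
move=> [cf sf]; split=> [x|x Mx].
  exact: (cvg_comp _ _ (cvgD cvg_id (cvg_cst v)) (cf (x + v))).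
apply: sf; rewrite -(ltrD2r `|v|); apply: lt_le_trans Mx _.
by have := ler_normB (x + v) v; rewrite addrK.
Qed.

Lemma intRn_translate n (M : R) (f : 'rV[R]_n -> R) v : 0 <= M ->
  cont_supp M f -> intRn (fun x => f (x + v)) = intRn f.
Proof.
elim: n M f v => [|n IH] M f v M0 cf /=.
  by congr (f _); rewrite [v]thinmx0 addr0.
have [cF sF] := intRn_slice M0 cf.
rewrite -[RHS](Rintegral_translate (v 0 0) cF sF).
apply: eq_Rintegral => a _.
rewrite -(IH _ _ (\row_i v 0 (lift ord0 i)) M0 (cont_supp_slice (a + v 0 0) cf)).
by congr intRn; apply/funext => y; rewrite [in LHS](cons_rV_surj v) -cons_rVD.
Qed.

(** The difference quotients along [v] integrate to zero by translation invariance, are bounded by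
    [C] by the mean value theorem, and converge pointwise to the derivative. Continuity of the
    derivative is not assumed. *)
Lemma intRn_derive n (M C : R) (f : 'rV[R]_n -> R) v : 0 <= M ->
  cont_supp M f -> (forall x, derivable f x v) ->
  (forall x, `|'D_v f x| <= C) -> intRn ('D_v f) = 0.
Proof.
move=> M0 cf df bf.
have k0 k : 0 < k.+1%:R^-1 :> R by rewrite invr_gt0.
pose M1 := M + `|v|.
have M10 : 0 <= M1 by rewrite addr_ge0.
have csf : cont_supp M1 f by apply: cont_suppW cf; rewrite lerDl.
have cs k : cont_supp M1 (fun x => f (x + k.+1%:R^-1 *: v)).
  apply: cont_suppW (cont_supp_translate _ cf); rewrite lerD2l normrZ.
  by rewrite ger0_norm ?(ltW (k0 k))// ler_piMl// invf_le1// ler1n.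
have cs0 : cont_supp M1 (fun _ : 'rV[R]_n => 0 : R) by split=> //; exact: cst_continuous.
have csN : cont_supp M1 (fun x => - 1 * f x + 0) by exact: cont_supp_lin.
(* The difference quotient with step [k.+1%:R^-1], spelled in the shape [c * f + g] of
   [cont_supp_lin] and [intRn_lin]. *)
pose fk k x := k.+1%:R * f (x + k.+1%:R^-1 *: v) + k.+1%:R * (- 1 * f x + 0).
have fkE k : (fun x => fk k x) =
    (fun x => k.+1%:R * f (x + k.+1%:R^-1 *: v) + (k.+1%:R * (- 1 * f x + 0) + 0)).
  by apply/funext => x; rewrite /fk !addr0.
have int0 : intRn (fun _ : 'rV[R]_n => 0 : R) = 0.
  apply/eqP; rewrite -normr_le0.
  by have := intRn_le (C := 0) M10 cs0; rewrite mul0r; apply => x; rewrite normr0.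
have int_fk k : intRn (fk k) = 0.
  rewrite [fk k]fkE (intRn_lin _ M10)//; last exact: cont_supp_lin.
  rewrite (intRn_lin _ M10)// (intRn_lin _ M10)// int0 !addr0.
  by rewrite (intRn_translate _ M0 cf) mulN1r mulrN subrr.
have : (fun k => intRn (fk k)) @ \oo --> intRn ('D_v f).
  apply: (@intRn_dominated _ M1 C) => //.
  - by move=> k; rewrite [fk k]fkE; apply: cont_supp_lin => //; exact: cont_supp_lin.
  - move=> k x; rewrite /fk addr0 mulN1r -mulrDr.
    have [|s _ ->] := @MVT_line R _ f x v (k.+1%:R^-1) (ltW (k0 k)).
      by move=> s _; exact: df.
    by rewrite mulrCA divff// mulr1.
  - move=> x; have /cvg_ex[l dl] := df x.
    have -> : 'D_v f x = l by exact: cvg_lim dl.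
    have /cvgr_dnbhsP dl' := dl.
    have : (fun k => (k.+1%:R^-1)^-1 *: (f (k.+1%:R^-1 *: v + x) - f x)) @ \oo --> l.
      apply: (dl' (fun k => k.+1%:R^-1)); split; last exact: cvg_harmonic.
      by move=> k; rewrite gt_eqF.
    apply: cvg_trans; apply: near_eq_cvg; near=> k.
    by rewrite /fk/= invrK addr0 mulN1r -mulrDr [X in f X - _]addrC.
under eq_fun do rewrite int_fk.
by move=> /cvg_lim <- //; exact: lim_cst.
Unshelve. all: by end_near. Qed.

End IntRn.

(** * Cutoff functions *)

Section Cutoff.
Variable R : realType.
Implicit Types s : R.

Definition ramp s : R := Num.max (s - 1) 0.
(** A rational profile that is zero up to 1 and tends to 1 at infinity. Squaring the ramp removes
    its corner, so the profile is C^1, and its derivative decays like [s^-3], fast enough for the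
    boundary-layer estimates. *)
Definition cutoff s : R := ramp s ^+ 2 / (1 + ramp s ^+ 2).
Definition cutoff' s : R := 2 * ramp s / (1 + ramp s ^+ 2) ^+ 2.

Lemma ramp_ge0 s : 0 <= ramp s.
Proof. by rewrite /ramp le_max lexx orbT. Qed.

Lemma ramp_gt1 s : 1 < s -> ramp s = s - 1.
Proof. by move=> s1; rewrite /ramp max_l// subr_ge0 ltW. Qed.

Lemma ramp_le1 s : s <= 1 -> ramp s = 0.
Proof. by move=> s1; rewrite /ramp max_r// subr_le0. Qed.

(** Differentiability as a remainder estimate without division; this form serves both for the
    squared ramp and for integrals depending on time. *)
Lemma is_derive_first_order (f : R -> R) s d :
  (forall e, 0 < e -> \forall h \near (0 : R),
     `|f (h + s) - f s - d * h| <= e * `|h|) -> is_derive s 1 f d.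
Proof.
move=> fh.
have lim : (h^-1 *: (f (h *: (1 : R) + s) - f s)) @[h --> 0^'] --> d.
  apply/cvgrPdist_le => e e0; near=> h.
  have h0 : h != 0 by near: h; exact: nbhs_dnbhs_neq.
  have he : `|f (h + s) - f s - d * h| <= e * `|h|.
    by near: h; apply: nbhs_dnbhs; exact: fh.
  have -> : h *: (1 : R) + s = h + s by rewrite /GRing.scale/= mulr1.
  have -> : d - h^-1 *: (f (h + s) - f s) = - (h^-1 * (f (h + s) - f s - d * h)).
    by rewrite [in RHS]mulrBr opprB mulrCA mulVf// mulr1.
  by rewrite normrN normrM normfV ler_pdivrMl ?normr_gt0// [_ * e]mulrC.
split; first by apply/cvg_ex; exists d.
exact: (cvg_lim (@Rhausdorff R) lim).
Unshelve. all: by end_near. Qed.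

Lemma is_derive_quadratic_bound (f : R -> R) s d :
  (forall h, `|f (h + s) - f s - d * h| <= h ^+ 2) -> is_derive s 1 f d.
Proof.
move=> fh; apply: is_derive_first_order => e e0; apply: filterS (nbhs0_le e0) => h he.
apply: le_trans (fh h) _; rewrite -real_normK ?num_real// expr2.
by rewrite ler_wpM2r.
Qed.

(** The remainder is at most [h ^+ 2] on each side of the corner at 1 and also across it, whence the
    four cases. *)
Lemma is_derive_ramp2 s : is_derive s 1 (fun s => ramp s ^+ 2) (2 * ramp s).
Proof.
apply: is_derive_quadratic_bound => h; rewrite ler_norml.
have [s1|s1] := leP s 1; have [h1|h1] := leP (h + s) 1.
- by rewrite !ramp_le1//; apply/andP; split; nra.
- by rewrite (ramp_le1 s1) (ramp_gt1 h1); apply/andP; split; nra.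
- by rewrite (ramp_le1 h1) (ramp_gt1 s1); apply/andP; split; nra.
- by rewrite (ramp_gt1 h1) (ramp_gt1 s1); apply/andP; split; nra.
Qed.

Lemma ramp_den_gt0 s : 0 < 1 + ramp s ^+ 2.
Proof. by rewrite ltr_wpDr// sqr_ge0. Qed.

Lemma is_derive_cutoff s : is_derive s 1 cutoff (cutoff' s).
Proof.
have d := is_derive_ramp2 s.
have n0 : 1 + ramp s ^+ 2 != 0 by rewrite gt_eqF// ramp_den_gt0.
have d1 : is_derive s 1 (fun s => 1 + ramp s ^+ 2) (0 + 2 * ramp s).
  exact: (is_deriveD (is_derive_cst (1 : R) s 1) d).
have d2 := is_deriveV (f := fun s => 1 + ramp s ^+ 2) n0 d1.
apply: (is_derive_eq (is_deriveM d d2)).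
rewrite /cutoff' /GRing.scale/=.
by field.
Qed.

Lemma ramp_continuous : continuous ramp.
Proof.
move=> s; apply/cvgrPdist_lt => e e0; near=> t.
have : `|s - t| < e by near: t; exact: cvgr_dist_lt.
apply: le_lt_trans; rewrite ler_norml.
have := ler_norm (s - t); have := ler_norm (t - s); rewrite distrC.
have [s1|s1] := leP s 1; have [t1|t1] := leP t 1.
- by rewrite !ramp_le1// => *; apply/andP; split; lra.
- by rewrite (ramp_le1 s1) (ramp_gt1 t1) => *; apply/andP; split; lra.
- by rewrite (ramp_le1 t1) (ramp_gt1 s1) => *; apply/andP; split; lra.
- by rewrite (ramp_gt1 t1) (ramp_gt1 s1) => *; apply/andP; split; lra.
Unshelve. all: by end_near. Qed.

Lemma cutoff_continuous : continuous cutoff.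
Proof.
move=> s; apply/differentiable_continuous/derivable1_diffP.
by case: (is_derive_cutoff s).
Qed.

Lemma cutoff'_continuous : continuous cutoff'.
Proof.
move=> s; have r : ramp x @[x --> s] --> ramp s by exact: ramp_continuous.
have r2 : ramp x ^+ 2 @[x --> s] --> ramp s ^+ 2 by exact: (cvgM r r).
have d : (1 + ramp x ^+ 2) @[x --> s] --> 1 + ramp s ^+ 2.
  by apply: cvgD => //; exact: cvg_cst.
have e : (1 + ramp x ^+ 2) ^+ 2 @[x --> s] --> (1 + ramp s ^+ 2) ^+ 2.
  exact: (cvgM d d).
have n : 2 * ramp x @[x --> s] --> 2 * ramp s.
  by apply: cvgM => //; exact: cvg_cst.
rewrite /continuous_at /cutoff'; apply: cvgM => //; apply: cvgV => //.
by rewrite expf_neq0// gt_eqF// ramp_den_gt0.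
Qed.

Lemma cutoff_le1 s : s <= 1 -> cutoff s = 0.
Proof. by move=> /ramp_le1 r0; rewrite /cutoff r0 expr0n mul0r. Qed.

Lemma cutoff'_le1 s : s <= 1 -> cutoff' s = 0.
Proof. by move=> /ramp_le1 r0; rewrite /cutoff' r0 mulr0 mul0r. Qed.

Lemma cutoff_ge0 s : 0 <= cutoff s.
Proof. by rewrite divr_ge0 ?sqr_ge0// ltW// ramp_den_gt0. Qed.

Lemma cutoff_lt1 s : cutoff s <= 1.
Proof. by rewrite ler_pdivrMr ?ramp_den_gt0// mul1r lerDr. Qed.

Lemma cutoff_near1 s : 0 < s -> `|1 - cutoff s| <= 2 / s.
Proof.
move=> s0; rewrite ger0_norm ?subr_ge0 ?cutoff_lt1//.
have d0 := ramp_den_gt0 s.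
have -> : 1 - cutoff s = (1 + ramp s ^+ 2)^-1.
  by rewrite /cutoff; field; rewrite gt_eqF.
rewrite ler_pdivlMr// mulrC ler_pdivrMr//.
have [s1|s1] := leP s 1; first by rewrite ramp_le1//; nra.
(* Completing the square: [8 * (2 * (1 + (s - 1) ^+ 2) - s) = (4 * s - 5) ^+ 2 + 7]. *)
by rewrite ramp_gt1//; have := sqr_ge0 (4 * s - 5); nra.
Qed.

Lemma cutoff'_ge0 s : 0 <= cutoff' s.
Proof.
by rewrite divr_ge0 ?sqr_ge0// mulr_ge0// ramp_ge0.
Qed.

(** This decay makes the boundary-layer term tend to zero at each point of the domain; the weaker
    bound on [s * cutoff' s] derived from it provides the domination. *)
Lemma sqr_cutoff'_le s : s ^+ 2 * cutoff' s <= 2.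
Proof.
have d0 := ramp_den_gt0 s.
rewrite /cutoff' mulrA ler_pdivrMr ?exprn_gt0//.
have [s1|s1] := leP s 1; first by rewrite ramp_le1//; nra.
rewrite ramp_gt1//; set m := s - 1.
have m0 : 0 < m by rewrite subr_gt0.
have -> : s = m + 1 by rewrite /m subrK.
have h1 : (m + 1) ^+ 2 <= 2 * (1 + m ^+ 2) by have := sqr_ge0 (m - 1); nra.
have h2 : 2 * m <= 1 + m ^+ 2 by have := sqr_ge0 (m - 1); nra.
apply: le_trans (ler_pM _ _ h1 h2) _; [nra|nra|].
by rewrite -mulrA -expr2.
Qed.

Lemma mul_cutoff'_le s : 0 <= s -> s * cutoff' s <= 2.
Proof.
move=> s0; have [s1|s1] := leP s 1; first by rewrite cutoff'_le1// mulr0.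
apply: le_trans (sqr_cutoff'_le s); rewrite ler_wpM2r ?cutoff'_ge0//.
by rewrite expr2 ler_peMr// ltW.
Qed.
End Cutoff.

(** * Finite sums and strict positivity of the iterated integral; auxiliary facts on derivatives and
    continuity *)

Lemma intRn0 (R : realType) n : intRn (fun _ : 'rV[R]_n => 0) = 0.
Proof.
apply/eqP; rewrite -normr_le0.
have c0 : cont_supp 0 (fun _ : 'rV[R]_n => 0 : R).
  by split=> //; exact: cst_continuous.
by have := intRn_le (C := 0) (lexx 0) c0; rewrite mul0r; apply => x; rewrite normr0.
Qed.

Lemma intRn_sum (R : realType) n (I : Type) (r : seq I) (M : R)
    (f : I -> 'rV[R]_n -> R) : 0 <= M -> (forall i, cont_supp M (f i)) ->
  cont_supp M (fun x => \sum_(i <- r) f i x) /\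
  intRn (fun x => \sum_(i <- r) f i x) = \sum_(i <- r) intRn (f i).
Proof.
move=> M0 cf; elim: r => [|i r [cs IH]].
  have -> : (fun x => \sum_(i <- [::]) f i x) = (fun=> 0).
    by apply/funext => x; rewrite big_nil.
  by rewrite big_nil intRn0; split=> //; split=> //; exact: cst_continuous.
have -> : (fun x => \sum_(i <- i :: r) f i x) =
    (fun x => 1 * f i x + \sum_(i <- r) f i x).
  by apply/funext => x; rewrite big_cons mul1r.
split; first exact: cont_supp_lin.
by rewrite (intRn_lin _ M0)// mul1r IH big_cons.
Qed.

Lemma cont_supp_bound (R : realType) n (M : R) (f : 'rV[R]_n -> R) :
  cont_supp M f -> exists2 C, 0 <= C & forall x, `|f x| <= C.
Proof.
move=> [cf sf].
have cK : compact [set y : 'rV[R]_n | `|y| <= M].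
  apply: bounded_closed_compact.
    exists M; split; first by rewrite num_real.
    by move=> x Mx y /= /le_trans; apply; exact: ltW.
  apply: (@closed_comp _ _ (fun y : 'rV[R]_n => `|y|) [set r | r <= M]).
    by move=> y _; exact: norm_continuous.
  exact: closed_le.
have /compact_bounded[C [_ hC]] := continuous_compact (continuous_subspaceT cf) cK.
exists (`|C| + 1) => [|x]; first by rewrite addr_ge0.
have [xM|/sf ->] := leP `|x| M; last by rewrite normr0 addr_ge0.
by apply: hC; [rewrite ltr_pwDr// ler_norm | exists x].
Qed.

(** By induction the slice integral through [x0] is positive; being continuous, it stays above half
    its value on an interval of length [d], and is nonnegative elsewhere. *)
Lemma intRn_gt0 (R : realType) n (M : R) (f : 'rV[R]_n -> R) x0 : 0 <= M ->
  cont_supp M f -> (forall x, 0 <= f x) -> 0 < f x0 -> 0 < intRn f.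
Proof.
elim: n f x0 => [|n IH] f x0 M0 cf f0 fx0 /=.
  by rewrite (_ : 0 = x0)//; rewrite [x0]thinmx0.
pose G a := intRn (fun y => f (cons_rV a y)).
have [cG sG] := intRn_slice M0 cf.
have G0 a : 0 <= G a by apply: intRn_ge0 => y; exact: f0.
pose a0 := x0 0 0.
have Ga0 : 0 < G a0.
  apply: (IH (fun y => f (cons_rV a0 y)) (\row_i x0 0 (lift ord0 i))) => //.
  - exact: cont_supp_slice.
  - by rewrite -cons_rV_surj.
have : \forall a \near a0, G a0 / 2 <= G a.
  by apply: (cvgr_ge _ (cG a0)); rewrite ltr_pdivrMr// ltr_pMr// ltr1n.
move=> /nbhs_ballP[d /= d0 hd].
have iG := cont_supp_integrable cG sG.
pose I : set R := `[a0 - d / 2, a0 + d / 2]%classic.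
pose h : R -> R := cst (G a0 / 2) \_ I.
have d2 : 0 < d / 2 by rewrite divr_gt0.
have Gp : 0 < G a0 / 2 by rewrite divr_gt0.
have hG a : h a <= G a.
  rewrite /h patchE; case: ifPn => [|_]; last exact: G0.
  rewrite inE /I /= in_itv/= -ler_distlC => ha; apply: hd; rewrite -ball_normE /=.
  by apply: le_lt_trans ha _; rewrite ltr_pdivrMr// ltr_pMr// ltr1n.
have mI : measurable I by exact: measurable_itv.
have ih := @bounded_supp_integrable R (`|a0| + d / 2) (G a0 / 2) h.
apply: lt_le_trans (le_Rintegral _ (ih _ _ _) iG (fun a _ => hG a)) => //.
- rewrite -Rintegral_mkcond Rintegral_cst//.
  rewrite (_ : fine _ = fine (lebesgue_measure (I : set R)))// lebesgue_measure_itv/=.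
  rewrite lte_fin ltrD2l gtrN// /= mulr_gt0//.
  have -> : a0 + d / 2 - (a0 - d / 2) = d by lra.
  by [].
- by apply/measurable_restrict => //; exact: measurable_cst.
- move=> a ha; rewrite /h patchE; case: ifPn => //.
  rewrite inE /I /= in_itv/= -ler_distlC => ha'; exfalso.
  have := ler_distD a0 a 0; rewrite !subr0 (distrC a) => h1.
  by move: (le_trans h1 (lerD ha' (lexx _))); rewrite leNgt addrC ha.
- by move=> a; rewrite /h patchE; case: ifPn => _; rewrite ?normr0 ?ger0_norm// ltW.
Qed.

Lemma derive_scale (R : realType) (V : normedModType R) (f : V -> R) x v (c : R) :
  differentiable f x -> 'D_(c *: v) f x = c * 'D_v f x.
Proof. by move=> df; rewrite !deriveE// linearZ. Qed.

Lemma derive_dir (R : realType) D (f : 'rV[R]_D -> R) x v :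
  differentiable f x -> 'D_v f x = \sum_j v 0 j * pd j f x.
Proof.
move=> df; rewrite deriveE// [in LHS](row_sum_delta v) linear_sum.
by apply: eq_bigr => j _; rewrite linearZ /pd deriveE.
Qed.

Lemma near_eq_cvg_to (T U : topologicalType) (f g : T -> U) (x : T) (l : U) :
  (\forall y \near x, f y = g y) -> f y @[y --> x] --> l ->
  g y @[y --> x] --> l.
Proof.
move=> fg; apply: cvg_trans; apply: (near_eq_cvg (F := nbhs x)).
by apply: filterS fg.
Qed.

Section PointwiseContinuity.
Variables (R : realType) (T : topologicalType).
Implicit Types (f g : T -> R) (x : T).

Lemma cont_atD f g x : {for x, continuous f} -> {for x, continuous g} ->
  {for x, continuous (fun y => f y + g y)}.
Proof. by move=> cf cg; apply: (@cvgD _ _ _ (nbhs x)). Qed.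

Lemma cont_atM f g x : {for x, continuous f} -> {for x, continuous g} ->
  {for x, continuous (fun y => f y * g y)}.
Proof. by move=> cf cg; apply: (@cvgM _ _ (nbhs x)). Qed.

Lemma cont_at_cst c x : {for x, continuous (fun _ : T => c : R)}.
Proof. exact: (@cvg_cst _ _ _ (nbhs x)). Qed.

Lemma cont_atN f x : {for x, continuous f} -> {for x, continuous (fun y => - f y)}.
Proof. by move=> cf; apply: (@cvgN _ _ _ (nbhs x)). Qed.

Lemma cont_at_comp f (h : R -> R) x : {for x, continuous f} ->
  {for f x, continuous h} -> {for x, continuous (fun y => h (f y))}.
Proof. by move=> cf ch; apply: (cvg_comp f h cf ch). Qed.

End PointwiseContinuity.

(** * Smooth functions *)

(** Allows differentiability to pass from [f] to a function [g] that agrees with it near [x], by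
    writing [g = f + (g - f)]. *)
Lemma near0_differentiable (R : realType) (V : normedModType R) (e : V -> R) x :
  (\forall y \near x, e y = 0) -> differentiable e x.
Proof.
move=> e0; have ex0 : e x = 0 by exact: (nbhs_singleton e0).
have eo : e =o_x (fun y => y - x).
  apply/eqoP => _/posnumP[eps]; apply: filterS e0 => y ->.
  by rewrite normr0 mulr_ge0.
apply/diffP; apply: (@getPex _ (fun (df : {linear V -> R}) => continuous df /\
  forall y, e y = e (lim (nbhs x)) + df (y - lim (nbhs x))
                  +o_(y \near x) (y - lim (nbhs x)))).
exists (\0 : {linear V -> R}); split; first exact: cst_continuous.
by apply: eqaddoEx => y; rewrite lim_id// ex0 /= !add0r {1}eo.
Qed.

Section Smooth.
Variables (R : realType) (V : normedModType R).
Implicit Types (U : set V) (f g : V -> R) (v x : V).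

Lemma Ck_onW k U f : Ck_on k.+1 U f -> Ck_on k U f.
Proof.
elim: k f => [|k IH] f [df Df].
  by move=> x /df/differentiable_continuous.
by split=> // v; apply: IH.
Qed.

Lemma Ck_on_sub k (U U' : set V) f : U' `<=` U -> Ck_on k U f -> Ck_on k U' f.
Proof.
move=> UU'; elim: k f => [|k IH] f /= => [cf x /UU'|[df Df]]; first exact: cf.
by split=> [x /UU'|v]; [exact: df|exact: IH].
Qed.

Lemma Ck_on_ext k U f g : open U -> (forall x, U x -> f x = g x) ->
  Ck_on k U f -> Ck_on k U g.
Proof.
move=> oU; elim: k f g => [|k IH] f g fg.
  move=> cf x Ux; rewrite /prop_for /continuous_at -fg//.
  apply: near_eq_cvg_to (cf x Ux).
  by apply: filterS (open_nbhs_nbhs (conj oU Ux)) => y /fg.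
have nfg x : U x -> \forall y \near x, f y = g y.
  by move=> Ux; apply: filterS (open_nbhs_nbhs (conj oU Ux)) => y /fg.
move=> [df Df]; split=> [x Ux|v].
  have gE : g = (fun y => f y + (g y - f y)) by apply/funext => y; rewrite addrC subrK.
  rewrite gE; apply: differentiableD; first exact: df.
  apply: near0_differentiable.
  by apply: filterS (nfg x Ux) => y ->; rewrite subrr.
apply: IH (Df v) => x Ux; exact/near_eq_derive/nfg.
Qed.

Lemma Ck_on_cst k U (c : R) : Ck_on k U (fun=> c).
Proof.
elim: k c => [|k IH] c; first by move=> x _; exact: cont_at_cst.
split=> [x _|v]; first exact: differentiable_cst.
have -> : (fun y => 'D_v (fun=> c) y) = (fun=> 0 : R).
  by apply/funext => y; exact: derive_cst.
exact: IH.
Qed.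

Lemma Ck_onD k U f g : open U -> Ck_on k U f -> Ck_on k U g ->
  Ck_on k U (fun x => f x + g x).
Proof.
move=> oU; elim: k f g => [|k IH] f g.
  by move=> cf cg x Ux; apply: cont_atD; [exact: cf|exact: cg].
move=> [df Df] [dg Dg]; split=> [x Ux|v].
  by apply: differentiableD; [exact: df|exact: dg].
apply: Ck_on_ext (IH _ _ (Df v) (Dg v)) => // x Ux.
by rewrite deriveD//; apply: diff_derivable; [exact: df|exact: dg].
Qed.

Lemma Ck_onM k U f g : open U -> Ck_on k U f -> Ck_on k U g ->
  Ck_on k U (fun x => f x * g x).
Proof.
move=> oU; elim: k f g => [|k IH] f g.
  by move=> cf cg x Ux; apply: cont_atM; [exact: cf|exact: cg].
move=> cf cg; have [df Df] := cf; have [dg Dg] := cg; split=> [x Ux|v].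
  by apply: differentiableM; [exact: df|exact: dg].
have := Ck_onD oU (IH _ _ (Ck_onW cf) (Dg v)) (IH _ _ (Ck_onW cg) (Df v)).
apply: Ck_on_ext => // x Ux.
by rewrite deriveM//; apply: diff_derivable; [exact: df|exact: dg].
Qed.

Lemma smooth_cst U c : smooth_on U (fun=> c).
Proof. by move=> k; exact: Ck_on_cst. Qed.

Lemma smoothD U f g : open U -> smooth_on U f -> smooth_on U g ->
  smooth_on U (fun x => f x + g x).
Proof. by move=> oU sf sg k; exact: Ck_onD. Qed.

Lemma smoothM U f g : open U -> smooth_on U f -> smooth_on U g ->
  smooth_on U (fun x => f x * g x).
Proof. by move=> oU sf sg k; exact: Ck_onM. Qed.

Lemma smooth_sum (I : Type) (r : seq I) U (f : I -> V -> R) : open U ->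
  (forall i, smooth_on U (f i)) -> smooth_on U (fun x => \sum_(i <- r) f i x).
Proof.
move=> oU sf k; elim: r => [|i r IH].
  by apply: Ck_on_ext (Ck_on_cst k U 0) => // x _; rewrite big_nil.
by apply: Ck_on_ext (Ck_onD oU (sf i k) IH) => // x _; rewrite big_cons.
Qed.

Lemma smooth_sub (U U' : set V) f : U' `<=` U -> smooth_on U f -> smooth_on U' f.
Proof. by move=> UU' sf k; exact: Ck_on_sub (sf k). Qed.

Lemma smooth_derive U f v : smooth_on U f -> smooth_on U (fun y => 'D_v f y).
Proof. by move=> sf k; have [_] := sf k.+1; exact. Qed.

Lemma smooth_diff U f x : smooth_on U f -> U x -> differentiable f x.
Proof. by move=> sf; have [df _] := sf 1; exact: df. Qed.

Lemma smooth_derivable U f x v : smooth_on U f -> U x -> derivable f x v.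
Proof. by move=> sf Ux; apply/diff_derivable/(smooth_diff sf). Qed.

Lemma smooth_cont U f x : smooth_on U f -> U x -> {for x, continuous f}.
Proof. by move=> sf; have cf := sf 0; exact: cf. Qed.

Lemma derive_sumE (I : Type) (r : seq I) (f : I -> V -> R) x v :
  (forall i, derivable (f i) x v) ->
  'D_v (fun y => \sum_(i <- r) f i y) x = \sum_(i <- r) 'D_v (f i) x /\
  derivable (fun y => \sum_(i <- r) f i y) x v.
Proof.
move=> df; elim: r => [|i r [IH dr]].
  have -> : (fun y => \sum_(i <- [::]) f i y) = cst 0.
    by apply/funext => y; rewrite big_nil.
  by rewrite big_nil derive_cst; split=> //; exact: derivable_cst.
have -> : (fun y => \sum_(i <- i :: r) f i y) = f i + (fun y => \sum_(i <- r) f i y).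
  by apply/funext => y; rewrite big_cons.
split; last exact: (derivableD (df i) dr).
by rewrite big_cons -IH; exact: (deriveD (df i) dr).
Qed.

(** The mean value theorem is applied to [f (y + e *: w) - f y] along [v], then to ['D_v f] along
    [w]. The left side is symmetric in [v] and [w], so exchanging them expresses it by the other
    mixed derivative. *)
Lemma mixed_difference U f x v w (e : R) : 0 <= e -> smooth_on U f ->
  (forall s t : R, 0 <= s <= e -> 0 <= t <= e -> U (x + s *: v + t *: w)) ->
  exists s, exists t, [/\ 0 <= s <= e, 0 <= t <= e &
    f (x + e *: v + e *: w) - f (x + e *: v) - (f (x + e *: w) - f x) =
    'D_w ('D_v f) (x + s *: v + t *: w) * e * e].
Proof.
move=> e0 sf hU; pose g y := f (y + e *: w) - f y.
have ee : 0 <= e <= e by rewrite e0 lexx.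
have oo : 0 <= (0 : R) <= e by rewrite e0 lexx.
have Ux s : 0 <= s <= e -> U (x + s *: v).
  by move=> se; have := hU s 0 se oo; rewrite scale0r addr0.
have dshift s : 0 <= s <= e ->
    is_derive (x + s *: v) v (fun y => f (y + e *: w)) ('D_v f (x + s *: v + e *: w)).
  move=> se; have d := @smooth_derivable U f _ v sf (hU s e se ee).
  have eq1 : (fun h : R => h^-1 *: (f (h *: v + (x + s *: v) + e *: w) - f (x + s *: v + e *: w)))
     = (fun h : R => h^-1 *: (f (h *: v + (x + s *: v + e *: w)) - f (x + s *: v + e *: w))).
    by apply/funext => h; rewrite !addrA.
  split; first by rewrite /derivable [X in cvg (X @ _)]eq1.
  by rewrite /derive [X in lim (X @ _)]eq1.
have dg s : 0 <= s <= e ->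
    is_derive (x + s *: v) v g ('D_v f (x + s *: v + e *: w) - 'D_v f (x + s *: v)).
  by move=> se; exact: (is_deriveB (dshift s se)
    (derivableP (smooth_derivable (v := v) sf (Ux s se)))).
have [s se es] := @MVT_line R _ g x v e e0 (fun s se => ex_derive (is_derive := dg s se)).
have [t te et] := @MVT_line R _ ('D_v f) (x + s *: v) w e e0
  (fun t te => smooth_derivable (v := w) (smooth_derive v sf) (hU s t se te)).
exists s, t; split=> //; rewrite -et -(derive_val (is_derive := dg s se)) -es /g.
by rewrite [x + e *: v + _]addrAC addrAC.
Qed.

(** One second difference equals a mixed derivative of either order at points close to [x], up to
    the same factor [d * d]; continuity brings both values within [e / 2] of those at [x]. *)
Lemma schwarz U f x v w : open U -> smooth_on U f -> U x ->
  'D_v ('D_w f) x = 'D_w ('D_v f) x.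
Proof.
move=> oU sf Ux; apply/eqP; rewrite -subr_eq0 -normr_le0.
apply/ler_addgt0Pl => e e0; rewrite addr0.
have c1 := smooth_cont (smooth_derive v (smooth_derive w sf)) Ux.
have c2 := smooth_cont (smooth_derive w (smooth_derive v sf)) Ux.
have e2 : 0 < e / 2 by rewrite divr_gt0.
have n1 := iffLR (cvgrPdist_le _ _) c1 _ e2.
have n2 := iffLR (cvgrPdist_le _ _) c2 _ e2.
have [r /= r0 hr] := iffLR (nbhs_ballP x _)
  (filterI (open_nbhs_nbhs (conj oU Ux)) (filterI (n1 _) (n2 _))).
(* The side [d] keeps the parallelogram within [r / 2] of [x]; the directions [a] and [b] are left
   generic to cover both orders of differentiation. *)
have [d d0 inb] : exists2 d : R, 0 < d & forall a b (s t : R),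
    `|a| + `|b| = `|v| + `|w| -> 0 <= s <= d -> 0 <= t <= d ->
    ball x r (x + s *: a + t *: b).
  have vw : 0 < `|v| + `|w| + 1 by rewrite ltr_wpDl// addr_ge0.
  exists (r / 2 / (`|v| + `|w| + 1)); first by rewrite !divr_gt0.
  set d := r / 2 / _ => a b s t ab /andP[s0 sd] /andP[t0 td].
  have d0 : 0 <= d by rewrite !divr_ge0// ltW.
  rewrite -ball_normE /= -addrA opprD addrA subrr add0r normrN.
  apply: le_lt_trans (ler_normD _ _) _; rewrite !normrZ !ger0_norm//.
  apply: (@le_lt_trans _ _ (d * (`|v| + `|w| + 1))).
    apply: (@le_trans _ _ (d * `|a| + d * `|b|)).
      by apply: lerD; exact: ler_wpM2r.
    by rewrite -mulrDr ab ler_wpM2l// lerDl.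
  by rewrite /d divfK ?gt_eqF// ltr_pdivrMr// ltr_pMr// ltr1n.
have [s [t [sd td e1]]] := mixed_difference (ltW d0) sf
  (fun s t hs ht => (hr _ (@inb v w s t erefl hs ht)).1).
have [t' [s' [td' sd' e1']]] := mixed_difference (ltW d0) sf
  (fun s t hs ht => (hr _ (@inb w v s t (addrC _ _) hs ht)).1).
have [_ [_ h1]] := hr _ (@inb v w s t erefl sd td).
have [_ [h2 _]] := hr _ (@inb w v t' s' (addrC _ _) td' sd').
move: e1 e1' h1 h2; move: ('D_w ('D_v f) (x + s *: v + t *: w))
  ('D_v ('D_w f) (x + t' *: w + s' *: v)) => A B e1 e1' h1 h2.
have AB : A = B.
  have dn0 : d != 0 by rewrite gt_eqF.
  apply: (mulIf dn0); apply: (mulIf dn0); rewrite /= -e1 -e1'.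
  by rewrite [x + d *: w + _]addrAC !opprB addrACA [RHS]addrACA [- _ + _]addrC.
rewrite AB in h1; move: h1 h2.
move: ('D_v ('D_w f) x) ('D_w ('D_v f) x) => A' B' h1 h2.
have -> : A' - B' = (A' - B) - (B' - B) by ring.
by rewrite [leRHS]splitr; apply: le_trans (ler_normB _ _) _; exact: lerD.
Qed.
End Smooth.

(** * Space-time functions and their restrictions to a fixed time *)

Section Slices.
Variables (R : realType) (D : nat).
Notation X := (R * 'rV[R]_D)%type.
Implicit Types (f : X -> R) (U : set X) (t : R) (x : 'rV[R]_D).

(** Time and space derivatives are both directional derivatives on the product space, so that
    smoothness on [U] and the symmetry of mixed derivatives cover them alike. *)
Definition dt f (p : X) : R := 'D_((1, 0) : X) f p.
Definition dx (j : 'I_D) f (p : X) : R := 'D_((0, ev R j) : X) f p.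

Lemma derive_slice f t x v :
  'D_v (fun y => f (t, y)) x = 'D_((0, v) : X) f (t, x).
Proof.
have e : (fun h : R => h^-1 *: (f (t, h *: v + x) - f (t, x))) =
   (fun h : R => h^-1 *: (f (h *: ((0, v) : X) + (t, x)) - f (t, x))).
  apply/funext => h; congr (_ *: (f _ - _)); apply: injective_projections => //=.
  by rewrite scaler0 add0r.
by rewrite /derive [X in lim (X @ _)]e.
Qed.

Lemma pd_slice f t x j : pd j (fun y => f (t, y)) x = dx j f (t, x).
Proof. exact: derive_slice. Qed.

Lemma dx_eq_near f f' t x j : (\forall y \near x, f (t, y) = f' (t, y)) ->
  dx j f (t, x) = dx j f' (t, x).
Proof. by rewrite -!pd_slice => ff'; exact: near_eq_derive. Qed.

Lemma is_derive_time f t x : derivable f (t, x) ((1, 0) : X) ->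
  is_derive t 1 (fun s => f (s, x)) (dt f (t, x)).
Proof.
move=> df.
have e : (fun h : R => h^-1 *: (f (h *: (1 : R) + t, x) - f (t, x))) =
   (fun h : R => h^-1 *: (f (h *: ((1, 0) : X) + (t, x)) - f (t, x))).
  apply/funext => h; congr (_ *: (f _ - _)); apply: injective_projections => //=.
  by rewrite scaler0 add0r.
split; first by rewrite /derivable [X in cvg (X @ _)]e.
by rewrite /derive [X in lim (X @ _)]e.
Qed.

Definition tslice U t : set 'rV[R]_D := [set x | U (t, x)].

Lemma pair_continuous t x : {for x, continuous (fun y : 'rV[R]_D => (t, y))}.
Proof.
apply: (@cvg_pair _ _ _ (nbhs x) (nbhs t) (nbhs x)); first exact: cvg_cst.
exact: cvg_id.
Qed.

Lemma tslice_open U t : open U -> open (tslice U t).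
Proof.
move=> oU; apply: (@open_comp _ _ (fun y : 'rV[R]_D => (t, y))) => // y _.
exact: pair_continuous.
Qed.

Lemma smooth_slice U f t : smooth_on U f ->
  smooth_on (tslice U t) (fun y => f (t, y)).
Proof.
move=> sf k; elim: k f {sf}(sf k) => [|k IH] f /= .
  by move=> cf x Ux; exact: (cvg_comp _ f (@pair_continuous t x) (cf _ Ux)).
move=> [df Df]; split=> [x Ux|v].
  apply: (@differentiable_comp _ _ _ _ (fun y => (t, y)) f); last exact: df.
  apply: differentiable_pair; first exact: differentiable_cst.
  exact: (ex_diff (is_diff_def := is_diff_id x)).
have -> : (fun y => 'D_v (fun y => f (t, y)) y) =
    (fun y => 'D_((0, v) : X) f (t, y)).
  by apply/funext => y; rewrite derive_slice.
exact: (IH _ (Df ((0, v) : X))).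
Qed.

Lemma smooth_dt U f : smooth_on U f -> smooth_on U (dt f).
Proof. exact: smooth_derive. Qed.

Lemma smooth_dx U f j : smooth_on U f -> smooth_on U (dx j f).
Proof. exact: smooth_derive. Qed.
End Slices.

(** * Vector differential operators in components *)

Section Coordinates.
Variables (R : realType) (D : nat).

Lemma derive_coord (V : normedModType R) (F : V -> 'rV[R]_D) x v i :
  (forall i, derivable (fun y => F y 0 i) x v) ->
  ('D_v F x) 0 i = 'D_v (fun y => F y 0 i) x.
Proof.
move=> dF; have dM : derivable F x v.
  by apply/derivable_mxP => a b; rewrite (ord1 a); exact: dF.
by rewrite derive_mx// mxE.
Qed.

Lemma lap_coord (V : set 'rV[R]_D) (F : 'rV[R]_D -> 'rV[R]_D) x i : open V ->
  (forall i, smooth_on V (fun y => F y 0 i)) -> V x ->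
  lap F x 0 i = \sum_j pd j (pd j (fun y => F y 0 i)) x.
Proof.
move=> oV sF Vx; rewrite /lap summxE; apply: eq_bigr => j _.
have e k y : V y -> (pd j F y) 0 k = pd j (fun z => F z 0 k) y.
  by move=> Vy; apply: derive_coord => l; exact: smooth_derivable (sF l) Vy.
have ne k : \forall y \near x, (pd j F y) 0 k = pd j (fun z => F z 0 k) y.
  by apply: filterS (open_nbhs_nbhs (conj oV Vx)) => y /e.
rewrite {1}/pd derive_coord.
  exact: near_eq_derive.
move=> k; apply: (near_eq_derivable (f := pd j (fun z => F z 0 k))).
  by apply: filterS (ne k) => y ->.
exact: smooth_derivable (smooth_derive _ (sF k)) Vx.
Qed.

Lemma div_coord (F : 'rV[R]_D -> 'rV[R]_D) x :
  (forall i j, derivable (fun y => F y 0 i) x (ev R j)) ->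
  div F x = \sum_j pd j (fun y => F y 0 j) x.
Proof.
by move=> dF; apply: eq_bigr => j _; apply: derive_coord.
Qed.

Lemma adv_coord (F : 'rV[R]_D -> 'rV[R]_D) x i :
  (forall i j, derivable (fun y => F y 0 i) x (ev R j)) ->
  adv F x 0 i = \sum_j F x 0 j * pd j (fun y => F y 0 i) x.
Proof.
move=> dF; rewrite /adv summxE; apply: eq_bigr => j _.
by rewrite mxE [in LHS]/pd derive_coord.
Qed.
End Coordinates.

(** * Scalar quantities that start at zero and remain zero *)

Lemma decay_zero (R : realType) (f df : R -> R) (a b : R) :
  (forall s, a <= s <= b -> is_derive s 1 f (df s)) ->
  (forall s, a <= s <= b -> df s <= 0) -> f a = 0 ->
  (forall s, a <= s <= b -> 0 <= f s) -> forall s, a <= s <= b -> f s = 0.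
Proof.
move=> hd hneg fa fpos s /andP[as_ sb]; apply/eqP; rewrite eq_le fpos ?as_ ?sb// andbT.
rewrite -fa; apply: (@ler0_derive1_nincr R f a b) => //.
- by move=> x; rewrite in_itv/= => /andP[ax xb]; case: (hd x); rewrite ?ltW.
- move=> x; rewrite in_itv/= => /andP[ax xb].
  have xab : a <= x <= b by rewrite !ltW.
  by have [_ e] := hd x xab; rewrite derive1E e; exact: hneg.
- apply: derivable_within_continuous => x; rewrite in_itv/= => xab.
  by case: (hd x xab).
Qed.

(** The square of [y] has derivative [- (2 * lam * y s ^+ 2)], nonpositive since [lam >= 0], so no
    explicit exponential solution is needed. *)
Lemma ode_zero (R : realType) (y : R -> R) (lam a b : R) : 0 <= lam ->
  (forall s, a <= s <= b -> is_derive s 1 y (- (lam * y s))) -> y a = 0 ->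
  forall s, a <= s <= b -> y s = 0.
Proof.
move=> lam0 hy ya s sab; apply/eqP; rewrite -sqrf_eq0; apply/eqP; move: s sab.
apply: (@decay_zero R (fun s => y s ^+ 2) (fun s => - (2 * lam * y s ^+ 2))).
- move=> s /hy h; apply: (is_derive_eq (is_deriveM h h)).
  by rewrite /GRing.scale/=; ring.
- by move=> s _; rewrite oppr_le0 mulr_ge0 ?sqr_ge0// mulr_ge0.
- by rewrite ya expr0n.
- by move=> s _; exact: sqr_ge0.
Qed.

(** * Integration over the domain *)

Section Domain.
Variables (R : realType) (D : nat) (Om : set 'rV[R]_D) (rho : 'rV[R]_D -> R).
Variable M : R.
Hypotheses (OmE : Om = [set x | rho x < 0]) (openOm : open Om) (M0 : 0 <= M)
  (OmM : forall x, Om x -> `|x| <= M) (crho : continuous rho).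
Implicit Types (f g : 'rV[R]_D -> R) (eta : R -> R) (x : 'rV[R]_D).

Definition bdd_cont f := (forall x, Om x -> {for x, continuous f}) /\
  exists C, forall x, Om x -> `|f x| <= C.

Lemma Om_rho x : Om x <-> rho x < 0.
Proof. by rewrite OmE. Qed.

Lemma Om_near x : Om x -> \forall y \near x, Om y.
Proof. by move=> Ox; exact: open_nbhs_nbhs. Qed.

Lemma bdd_cont_ge0 f : bdd_cont f ->
  exists2 C, 0 <= C & forall x, Om x -> `|f x| <= C.
Proof.
move=> [_ [C fC]]; exists `|C| => // x Ox.
exact: le_trans (fC x Ox) (ler_norm C).
Qed.

Lemma bdd_cont_ext f g : (forall x, Om x -> f x = g x) -> bdd_cont f -> bdd_cont g.
Proof.
move=> fg [cf [C bf]]; split=> [x Ox|]; last first.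
  by exists C => x Ox; rewrite -fg//; exact: bf.
rewrite /prop_for /continuous_at -(fg _ Ox); apply: near_eq_cvg_to (cf x Ox).
by apply: filterS (Om_near Ox) => y /fg.
Qed.

Lemma bdd_cont_cst c : bdd_cont (fun=> c).
Proof.
split=> [x _|]; first exact: cst_continuous.
by exists `|c|.
Qed.

Lemma bdd_contD f g : bdd_cont f -> bdd_cont g -> bdd_cont (fun x => f x + g x).
Proof.
move=> [cf [C bf]] [cg [C' bg]]; split=> [x Ox|].
  by apply: cont_atD; [exact: cf|exact: cg].
exists (C + C') => x Ox; apply: le_trans (ler_normD _ _) _.
by rewrite lerD// ?bf// bg.
Qed.

Lemma bdd_contM f g : bdd_cont f -> bdd_cont g -> bdd_cont (fun x => f x * g x).
Proof.
move=> nf ng; have [C C0 bf] := bdd_cont_ge0 nf; have [C' C'0 bg] := bdd_cont_ge0 ng.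
split=> [x Ox|]; first by apply: cont_atM; [exact: (proj1 nf)|exact: (proj1 ng)].
by exists (C * C') => x Ox; rewrite normrM ler_pM// ?bf ?bg.
Qed.

Lemma bdd_contZ c f : bdd_cont f -> bdd_cont (fun x => c * f x).
Proof. by move=> ?; apply: bdd_contM => //; exact: bdd_cont_cst. Qed.

Lemma bdd_cont_sum (I : Type) (r : seq I) (f : I -> 'rV[R]_D -> R) :
  (forall i, bdd_cont (f i)) -> bdd_cont (fun x => \sum_(i <- r) f i x).
Proof.
move=> nf; elim: r => [|i r IH].
  by apply: bdd_cont_ext (bdd_cont_cst 0) => x _; rewrite big_nil.
by apply: bdd_cont_ext (bdd_contD (nf i) IH) => x _; rewrite big_cons.
Qed.

(** With [eta = cutoff] this is a cutoff supported where [- rho >= 1 / (k + 1)]; with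
    [eta = cutoff'] it is the profile of the boundary layer produced by differentiating that cutoff.
    The index [k.+1] keeps the scale positive. *)
Definition layer (eta : R -> R) (k : nat) x := eta (k.+1%:R * - rho x).

Lemma layer_continuous (eta : R -> R) k (x : 'rV[R]_D) : continuous eta ->
  {for x, continuous (layer eta k)}.
Proof.
move=> ce; apply: cont_at_comp; last exact: ce.
by apply: cont_atM; [exact: cont_at_cst|apply: cont_atN; exact: crho].
Qed.

(** Off [Om] the argument of [eta] is at most 0, while [eta] vanishes up to 1; the gap leaves room
    for a whole neighbourhood. Hence the product with a function that is continuous only in [Om] is
    continuous everywhere. *)
Lemma layer_near0 eta k x : (forall s, s <= 1 -> eta s = 0) -> ~ Om x ->
  \forall y \near x, layer eta k y = 0.
Proof.
move=> e0 /Om_rho/negP; rewrite -leNgt => rx.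
have : {for x, continuous (fun y => k.+1%:R * - rho y)}.
  by apply: cont_atM; [exact: cont_at_cst|apply: cont_atN; exact: crho].
rewrite /prop_for/continuous_at => /cvgr_le/(_ 1) h; apply: filterS (h _) => [y /e0//|].
by apply: le_lt_trans ltr01; rewrite mulrN oppr_le0 mulr_ge0.
Qed.

Lemma layer_out eta k x : (forall s, s <= 1 -> eta s = 0) -> ~ Om x ->
  layer eta k x = 0.
Proof. by move=> e0 Ox; exact: nbhs_singleton (layer_near0 k e0 Ox). Qed.

Lemma layer_supp eta k f : continuous eta -> (forall s, s <= 1 -> eta s = 0) ->
  bdd_cont f -> cont_supp M (fun x => layer eta k x * f x).
Proof.
move=> ce e0 [cf bf]; split=> [x|x Mx].
  have [Ox|Ox] := pselect (Om x).
    by apply: cont_atM; [exact: layer_continuous|exact: cf].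
  rewrite /prop_for /continuous_at layer_out// mul0r.
  apply: near_eq_cvg_to (cvg_cst 0).
  by apply: filterS (layer_near0 k e0 Ox) => y ->; rewrite mul0r.
by rewrite layer_out ?mul0r// => /OmM; rewrite leNgt Mx.
Qed.

Notation J := (intOmega Om).
Notation zeta := (layer (@cutoff R)).

Lemma zeta_out k x : ~ Om x -> zeta k x = 0.
Proof. by apply: layer_out; exact: cutoff_le1. Qed.

Lemma zeta_supp k f : bdd_cont f -> cont_supp M (fun x => zeta k x * f x).
Proof. by apply: layer_supp; [exact: cutoff_continuous|exact: cutoff_le1]. Qed.

Lemma zeta_bound k x : `|zeta k x| <= 1.
Proof. by rewrite ger0_norm ?cutoff_ge0// cutoff_lt1. Qed.

Lemma cvg_inv_natS (c : R) : (c / k.+1%:R) @[k --> \oo] --> (0 : R).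
Proof.
rewrite -(mulr0 c); apply: cvgM; first exact: cvg_cst.
exact: cvg_harmonic.
Qed.

Lemma zeta_cvg1 x : Om x -> zeta k x @[k --> \oo] --> (1 : R).
Proof.
move=> /Om_rho rx; have r0 : 0 < - rho x by rewrite oppr_gt0.
apply/cvgrPdist_le => e e0.
have := cvg_inv_natS (2 / - rho x) => /cvgr_le/(_ e e0).
apply: filterS => k; apply: le_trans.
have := @cutoff_near1 R (k.+1%:R * - rho x); rewrite mulr_gt0// => /(_ isT).
by rewrite invfM mulrA mulrAC.
Qed.

(** The bridge from [intOmega] to integrals of continuous functions: linearity and bounds hold for
    each cutoff and are carried over in the limit. *)
Lemma int_zeta_cvg f : bdd_cont f ->
  intRn (fun x => zeta k x * f x) @[k --> \oo] --> J f.
Proof.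
move=> nf; have [C C0 bf] := bdd_cont_ge0 nf.
apply: (@intRn_dominated _ _ M C (fun k x => zeta k x * f x)) => //.
- by move=> k; exact: zeta_supp.
- move=> k x; have [Ox|Ox] := pselect (Om x).
    by rewrite normrM -[leRHS]mul1r ler_pM// ?zeta_bound// bf.
  by rewrite zeta_out// mul0r normr0.
- move=> x; have [Ox|Ox] := pselect (Om x).
    rewrite indicE mem_set//; apply: cvgM; last exact: cvg_cst.
    exact: zeta_cvg1.
  rewrite indicE memNset// mul0r.
  by under eq_fun do rewrite zeta_out// mul0r; exact: cvg_cst.
Qed.

Lemma J_ext f g : (forall x, Om x -> f x = g x) -> J f = J g.
Proof.
move=> fg; congr intRn; apply/funext => x; rewrite indicE.
by have [/set_mem/fg ->|_] := boolP (x \in Om); rewrite ?mul0r.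
Qed.

Lemma J_lin c f g : bdd_cont f -> bdd_cont g ->
  J (fun x => c * f x + g x) = c * J f + J g.
Proof.
move=> nf ng.
have nfg : bdd_cont (fun x => c * f x + g x) by apply: bdd_contD => //; exact: bdd_contZ.
have l1 := int_zeta_cvg nfg.
have l2 : (c * intRn (fun x => zeta k x * f x) + intRn (fun x => zeta k x * g x))
    @[k --> \oo] --> c * J f + J g.
  apply: cvgD; last exact: int_zeta_cvg.
  by apply: cvgM; [exact: cvg_cst|exact: int_zeta_cvg].
rewrite -(cvg_lim _ l1)// -(cvg_lim _ l2)//; congr (lim (_ @ \oo)).
apply/funext => k; rewrite -(intRn_lin c M0 (zeta_supp k nf) (zeta_supp k ng)).
by congr intRn; apply/funext => x; rewrite mulrDr mulrCA.
Qed.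

Lemma J_D f g : bdd_cont f -> bdd_cont g -> J (fun x => f x + g x) = J f + J g.
Proof.
by move=> nf ng; rewrite -[J f]mul1r -J_lin//; apply: J_ext => x _; rewrite mul1r.
Qed.

Lemma J_0 : J (fun=> 0) = 0.
Proof.
rewrite -[RHS](intRn0 R D); congr intRn.
by apply/funext => x; rewrite mulr0.
Qed.

Lemma J_Z c f : bdd_cont f -> J (fun x => c * f x) = c * J f.
Proof.
move=> nf; rewrite -[RHS]addr0 -J_0 -J_lin//; last exact: bdd_cont_cst.
by apply: J_ext => x _; rewrite addr0.
Qed.

Lemma J_N f : bdd_cont f -> J (fun x => - f x) = - J f.
Proof.
by move=> nf; rewrite -mulN1r -J_Z//; apply: J_ext => x _; rewrite mulN1r.
Qed.

Lemma J_sum (I : Type) (r : seq I) (f : I -> 'rV[R]_D -> R) :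
  (forall i, bdd_cont (f i)) ->
  J (fun x => \sum_(i <- r) f i x) = \sum_(i <- r) J (f i).
Proof.
move=> nf; elim: r => [|i r IH].
  by rewrite big_nil -[RHS]J_0; apply: J_ext => x _; rewrite big_nil.
rewrite big_cons -IH -J_D//; last exact: bdd_cont_sum.
by apply: J_ext => x _; rewrite big_cons.
Qed.

Lemma J_norm_le C f : 0 <= C -> bdd_cont f -> (forall x, Om x -> `|f x| <= C) ->
  `|J f| <= C * (2 * M) ^+ D.
Proof.
move=> C0 nf bf; apply: (cvgr_to_le (cvg_norm (int_zeta_cvg nf))).
apply: nearW => k; apply: intRn_le => //; first exact: zeta_supp.
move=> x; have [Ox|Ox] := pselect (Om x).
  by rewrite normrM -[leRHS]mul1r ler_pM// ?zeta_bound// bf.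
by rewrite zeta_out// mul0r normr0.
Qed.

Lemma J_ge0 f : (forall x, Om x -> 0 <= f x) -> 0 <= J f.
Proof.
move=> f0; apply: intRn_ge0 => x; rewrite indicE.
by have [/set_mem/f0|_] := boolP (x \in Om); rewrite ?mul1r ?mul0r.
Qed.

(** If [f x > 0], some cutoff exceeds 1/2 at [x], so [J (zeta k * f)] is positive, although it is at
    most [J f = 0]. *)
Lemma J_eq0 f : bdd_cont f -> (forall x, Om x -> 0 <= f x) -> J f = 0 ->
  forall x, Om x -> f x = 0.
Proof.
move=> nf f0 Jf x Ox; apply/eqP; apply: contrapT => /negP fx.
have {}fx : 0 < f x by rewrite lt_neqAle eq_sym fx f0.
have : \forall k \near \oo, 1 / 2 < zeta k x.
  by apply: (cvgr_gt _ (zeta_cvg1 Ox)); rewrite ltr_pdivrMr// mul1r ltr1n.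
move=> [k _ /(_ k (leqnn k)) /= zx].
have nz : bdd_cont (fun y => zeta k y * f y).
  apply: bdd_contM => //; split=> [y _|]; last by exists 1 => y _; exact: zeta_bound.
  exact: layer_continuous k y (@cutoff_continuous R).
have : 0 < J (fun y => zeta k y * f y).
  have -> : J (fun y => zeta k y * f y) = intRn (fun y => zeta k y * f y).
    congr intRn; apply/funext => y; rewrite indicE.
    have [_|] := boolP (y \in Om); first by rewrite mul1r.
    by rewrite notin_setE => /zeta_out ->; rewrite !mul0r.
  apply: (intRn_gt0 M0 (zeta_supp k nf) (x0 := x)) => [y|].
    have [/f0 ?|/zeta_out ->] := pselect (Om y); last by rewrite mul0r.
    by rewrite mulr_ge0 ?cutoff_ge0.
  by rewrite mulr_gt0// (lt_trans _ zx).
have : 0 <= J (fun y => f y + (-1) * (zeta k y * f y)).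
  apply: J_ge0 => y Oy; rewrite mulN1r -[X in X - _]mul1r -mulrBl.
  by rewrite mulr_ge0 ?f0// subr_ge0 cutoff_lt1.
rewrite J_D//; last exact: bdd_contZ.
rewrite J_Z// Jf add0r mulN1r oppr_ge0 => /le_lt_trans h /h.
by rewrite ltxx.
Qed.

(** * Compactness of the closure and integrals of divergences *)

Hypotheses (drho : forall x, differentiable rho x)
  (cdrho : forall v x, {for x, continuous (fun y => 'D_v rho y)}).

Lemma closure_le (h : 'rV[R]_D -> R) c x : continuous h ->
  (forall y, Om y -> h y <= c) -> closure Om x -> h x <= c.
Proof.
move=> ch hc clx; rewrite leNgt; apply/negP => cx.
have /clx[y [Oy /=]] : \forall y \near x, c < h y.
  exact: (cvgr_gt _ (ch x)).
by rewrite ltNge hc.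
Qed.

Lemma closure_rho x : closure Om x -> rho x <= 0.
Proof. by apply: closure_le => // y /Om_rho/ltW. Qed.

Lemma compact_closure : compact (closure Om).
Proof.
apply: bounded_closed_compact; last exact: closed_closure.
exists M; split; first by rewrite num_real.
move=> e Me x clx; apply: le_trans (ltW Me).
apply: (@closure_le (fun x : 'rV[R]_D => `|x|)) clx => //.
exact: norm_continuous.
Qed.

Lemma bdd_closure f : (forall x, closure Om x -> {for x, continuous f}) ->
  exists2 C, 0 <= C & forall x, closure Om x -> `|f x| <= C.
Proof.
move=> cf.
have wf : {within closure Om, continuous f}.
  by apply: continuous_in_subspaceT => x /set_mem; exact: cf.
have /compact_bounded[C [_ hC]] := continuous_compact wf compact_closure.
exists (`|C| + 1) => [|x clx]; first by rewrite addr_ge0.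
by apply: hC; [rewrite ltr_pwDr// ler_norm | exists x].
Qed.

Lemma bdd_cont_closure f : (forall x, closure Om x -> {for x, continuous f}) ->
  bdd_cont f.
Proof.
move=> cf; have [C _ bf] := bdd_closure cf.
split=> [x Ox|]; first exact/cf/subset_closure.
by exists C => x Ox; exact/bf/subset_closure.
Qed.

Lemma is_derive_zeta k x v : is_derive x v (zeta k)
  (cutoff' (k.+1%:R * - rho x) * (k.+1%:R * - 'D_v rho x)).
Proof.
apply: is_derive_of_line.
have dr : is_derive (0 : R) 1 (fun s : R => rho (x + s *: v)) ('D_v rho x).
  have := @is_derive_line R _ rho x v 0.
  by rewrite scale0r addr0; apply; exact: diff_derivable.
have dl : is_derive (0 : R) 1 (fun s : R => k.+1%:R * - rho (x + s *: v))
    (k.+1%:R * - 'D_v rho x).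
  exact: (is_deriveZ k.+1%:R (is_deriveN dr)).
have dc : is_derive ((fun s : R => k.+1%:R * - rho (x + s *: v)) 0) 1
    (@cutoff R) (cutoff' (k.+1%:R * - rho x)).
  by rewrite scale0r addr0; exact: is_derive_cutoff.
exact: (@is_derive1_comp R (@cutoff R)
  (fun s : R => k.+1%:R * - rho (x + s *: v)) 0 _ _ dc dl).
Qed.

Notation flux F := (fun x => \sum_j F j x * pd j rho x).

Lemma is_derive_zetaM (F : 'rV[R]_D -> R) k (j : 'I_D) x :
  (Om x -> derivable F x (ev R j)) ->
  is_derive x (ev R j) (fun x => zeta k x * F x)
    (zeta k x * pd j F x +
     - k.+1%:R * (layer (@cutoff' R) k x * (F x * pd j rho x))).
Proof.
move=> dF; have [Ox|Ox] := pselect (Om x).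
  have h := is_deriveM (is_derive_zeta k x (ev R j)) (derivableP (dF Ox)).
  apply: (is_derive_eq h); rewrite /GRing.scale/= /layer /pd.
  by ring.
rewrite zeta_out// (layer_out k (@cutoff'_le1 R) Ox) !mul0r mulr0 addr0.
apply: (near_eq_is_derive (f := cst 0)).
by apply: filterS (layer_near0 k (@cutoff_le1 R) Ox) => y ->; rewrite mul0r.
Qed.

(** With [s = k.+1%:R * - rho x] the integrand is bounded by [C * (s * cutoff' s)]. This is at most
    [C * 2], the domination, and at most [C * 2 / s], which tends to zero at each fixed point of
    [Om]. *)
Lemma flux_cvg0 (G : 'rV[R]_D -> R) C : bdd_cont G -> 0 <= C ->
  (forall x, Om x -> `|G x| <= C * `|rho x|) ->
  intRn (fun x => k.+1%:R * (layer (@cutoff' R) k x * G x)) @[k --> \oo]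
    --> (0 : R).
Proof.
move=> nG C0 bG; rewrite -[X in _ --> X](intRn0 R D).
have cs k : cont_supp M (fun x => layer (@cutoff' R) k x * G x).
  by apply: layer_supp => //; [exact: cutoff'_continuous|exact: cutoff'_le1].
have bnd k x : Om x -> `|k.+1%:R * (layer (@cutoff' R) k x * G x)| <=
    C * (k.+1%:R * - rho x * cutoff' (k.+1%:R * - rho x)).
  move=> Ox; have /Om_rho rx := Ox.
  rewrite normrM (normrM (layer _ _ _)) ger0_norm// ger0_norm ?cutoff'_ge0//.
  rewrite [leRHS](_ : _ = k.+1%:R * (layer (@cutoff' R) k x * (C * `|rho x|))).
    by rewrite ler_wpM2l// ler_wpM2l ?cutoff'_ge0// bG.
  by rewrite ltr0_norm// /layer; ring.
have cs0 : cont_supp M (fun _ : 'rV[R]_D => 0 : R).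
  by split=> //; exact: cst_continuous.
apply: (@intRn_dominated _ _ M (C * 2)
  (fun k x => k.+1%:R * (layer (@cutoff' R) k x * G x))) => //.
- move=> k; have := cont_supp_lin k.+1%:R (cs k) cs0.
  by under [X in cont_supp _ X]eq_fun do rewrite addr0.
- move=> k x; have [Ox|Ox] := pselect (Om x); last first.
    by rewrite (layer_out k (@cutoff'_le1 R) Ox) mul0r mulr0 normr0 mulr_ge0.
  apply: le_trans (bnd k x Ox) _; rewrite ler_wpM2l// mul_cutoff'_le//.
  by rewrite mulr_ge0// oppr_ge0 ltW//; apply/Om_rho.
- move=> x; have [Ox|Ox] := pselect (Om x); last first.
    under eq_fun do rewrite (layer_out _ (@cutoff'_le1 R) Ox) mul0r mulr0.
    exact: cvg_cst.
  have /Om_rho rx := Ox; have r0 : 0 < - rho x by rewrite oppr_gt0.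
  apply/cvgrPdist_le => e e0.
  have := cvg_inv_natS (C * 2 / - rho x) => /cvgr_le/(_ e e0).
  apply: filterS => k; apply: le_trans; rewrite sub0r normrN.
  apply: le_trans (bnd k x Ox) _.
  have s0 : 0 < k.+1%:R * - rho x by rewrite mulr_gt0.
  rewrite [leRHS](_ : _ = C * (2 / (k.+1%:R * - rho x))); last first.
    by rewrite [in RHS]invfM [X in _ = C * (2 * X)]mulrC !mulrA.
  rewrite ler_wpM2l// ler_pdivlMr// mulrAC -expr2; exact: sqr_cutoff'_le.
Qed.

(* Multiplying by the cutoff [zeta k] and integrating by parts leaves the
   term [k cutoff'(-k rho) (F . grad rho)], which is bounded and tends to [0]
   pointwise because the flux is [O(|rho|)]. *)
Lemma J_div (F : 'I_D -> 'rV[R]_D -> R) C : (forall j, bdd_cont (F j)) ->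
  (forall j x, Om x -> derivable (F j) x (ev R j)) ->
  (forall j, bdd_cont (pd j (F j))) -> 0 <= C ->
  (forall x, Om x -> `|flux F x| <= C * `|rho x|) ->
  J (fun x => \sum_j pd j (F j) x) = 0.
Proof.
move=> nF dF ndF C0 bF.
have nr j : bdd_cont (pd j rho) by apply: bdd_cont_closure => x _; exact: cdrho.
have nG : bdd_cont (flux F) by apply: bdd_cont_sum => j; exact: bdd_contM.
have cs (j : 'I_D) k : cont_supp M (fun x => layer (@cutoff' R) k x * (F j x * pd j rho x)).
  apply: layer_supp; [exact: cutoff'_continuous|exact: cutoff'_le1|exact: bdd_contM].
have int0 k j : intRn (fun x => zeta k x * pd j (F j) x) =
    intRn (fun x => k.+1%:R * (layer (@cutoff' R) k x * (F j x * pd j rho x))).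
  have cs0 : cont_supp M (fun _ : 'rV[R]_D => 0 : R).
    by split=> //; exact: cst_continuous.
  have cd := cont_supp_lin (- k.+1%:R) (cs j k) (zeta_supp k (ndF j)).
  have [B _ hB] := cont_supp_bound cd.
  have dd x := is_derive_zetaM k (dF j x).
  have dE x : 'D_(ev R j) (fun x => zeta k x * F j x) x =
      - k.+1%:R * (layer (@cutoff' R) k x * (F j x * pd j rho x)) +
      zeta k x * pd j (F j) x.
    by rewrite (derive_val (is_derive := dd x)) addrC.
  have hB' x : `|'D_(ev R j) (fun x => zeta k x * F j x) x| <= B by rewrite dE.
  have := intRn_derive M0 (zeta_supp k (nF j))
    (fun x => ex_derive (is_derive := dd x)) hB'.
  rewrite [X in intRn X](funext dE) (intRn_lin _ M0 (cs j k) (zeta_supp k (ndF j))).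
  rewrite mulNr addrC => /subr0_eq ->.
  have := intRn_lin k.+1%:R M0 (cs j k) cs0; rewrite intRn0 addr0 => <-.
  by congr intRn; apply/funext => x; rewrite addr0.
have csk (j : 'I_D) k : cont_supp M
    (fun x => k.+1%:R * (layer (@cutoff' R) k x * (F j x * pd j rho x))).
  have cs0 : cont_supp M (fun _ : 'rV[R]_D => 0 : R).
    by split=> //; exact: cst_continuous.
  have := cont_supp_lin k.+1%:R (cs j k) cs0.
  by under [X in cont_supp _ X]eq_fun do rewrite addr0.
have l1 := int_zeta_cvg (bdd_cont_sum (index_enum 'I_D) ndF).
have l2 := flux_cvg0 nG C0 bF.
rewrite -[LHS](cvg_lim _ l1)// -[RHS](cvg_lim _ l2)//; congr (lim (_ @ \oo)).
apply/funext => k.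
have [_ e1] := intRn_sum (index_enum 'I_D) M0 (fun j => zeta_supp k (ndF j)).
have [_ e2] := intRn_sum (index_enum 'I_D) M0 (fun j => csk j k).
rewrite [LHS](_ : _ = intRn (fun x => \sum_j zeta k x * pd j (F j) x)); last first.
  congr intRn; by apply/funext => x; rewrite mulr_sumr.
rewrite e1 (eq_bigr _ (fun j _ => int0 k j)) -e2.
by congr intRn; apply/funext => x; rewrite -!mulr_sumr.
Qed.

(** * Behaviour near the boundary *)

Lemma eq_closure f g : (forall x, closure Om x -> {for x, continuous f}) ->
  (forall x, closure Om x -> {for x, continuous g}) ->
  (forall x, Om x -> f x = g x) -> forall x, closure Om x -> f x = g x.
Proof.
move=> cf cg fg x clx; apply/eqP; rewrite -subr_eq0; apply/eqP.
apply: contrapT => /eqP nz.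
have ch : {for x, continuous (fun y => `|f y - g y|)}.
  apply: (@cont_at_comp _ _ (fun y => f y - g y) (fun r : R => `|r|)).
    by apply: cont_atD; [exact: cf|apply: cont_atN; exact: cg].
  exact: norm_continuous.
have /clx[y [Oy /=]] : \forall y \near x, 0 < `|f y - g y|.
  by apply: (cvgr_gt _ ch); rewrite normr_gt0.
by rewrite fg// subrr normr0 ltxx.
Qed.

Hypothesis grho : forall x, rho x = 0 -> grad rho x != 0.

(** The direction [v] is the gradient of [rho] at [p], kept constant. The derivative along it is the
    squared length of that gradient at [p], and at least half of it nearby; [rho] increases along
    [v], so following [v] leads out of [Om]. *)
Lemma inward_field p : rho p = 0 -> exists v, exists2 c, 0 < c &
  \forall y \near p, c <= 'D_v rho y.
Proof.
move=> p0; pose v := grad rho p.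
have Dv : 'D_v rho p = \sum_j v 0 j ^+ 2.
  rewrite derive_dir//; apply: eq_bigr => j _.
  by rewrite expr2 /v /grad !mxE.
have vp : 0 < 'D_v rho p.
  rewrite Dv lt_neqAle sumr_ge0 ?andbT => [|j _]; last exact: sqr_ge0.
  apply: contra (grho p0); rewrite eq_sym psumr_eq0 => [/allP h|j _]; last exact: sqr_ge0.
  apply/eqP/rowP => j; rewrite [RHS]mxE; apply/eqP.
  by rewrite -[_ == 0]sqrf_eq0; apply: (h j); rewrite mem_index_enum.
exists v; exists ('D_v rho p / 2); first by rewrite divr_gt0.
by apply: (cvgr_ge _ (@cdrho v p)); rewrite ltr_pdivrMr// ltr_pMr// ltr1n.
Qed.

Lemma boundary_chart p : rho p = 0 -> exists v, exists c, exists d,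
  [/\ 0 < c, 0 < d & \forall x \near p, forall s, `|s| <= d ->
      c <= 'D_v rho (x + s *: v)].
Proof.
move=> /inward_field[v [c c0]] /nbhs_ballP[r /= r0 hr].
(* A point within [r / 2] of [p], displaced by at most [d * |v|], hence by at most [r / 2], stays in
   the ball where the bound holds. *)
pose d := r / 2 / (`|v| + 1).
have v1 : 0 < `|v| + 1 by rewrite ltr_wpDl.
have r2 : 0 < r / 2 by rewrite divr_gt0.
exists v, c, d; split=> //; first by rewrite divr_gt0.
have : \forall x \near p, `|p - x| < r / 2.
  by apply/nbhs_ballP; exists (r / 2) => // x; rewrite -ball_normE.
apply: filterS => x px s sd; apply: hr; rewrite -ball_normE /=.
rewrite opprD addrA; apply: le_lt_trans (ler_normB _ _) _.
rewrite [ltRHS](splitr r) ltr_leD// normrZ.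
apply: (@le_trans _ _ (d * (`|v| + 1))).
  by rewrite ler_pM// lerDl.
by rewrite /d divfK// gt_eqF.
Qed.

Lemma rho_ray x v (c s : R) : 0 <= s ->
  (forall s', 0 <= s' <= s -> c <= 'D_v rho (x + s' *: v)) ->
  c * s <= rho (x + s *: v) - rho x.
Proof.
move=> s0 h; have [s' s's ->] :=
  MVT_line s0 (fun s' _ => diff_derivable (v := v) (drho (x + s' *: v))).
by rewrite ler_wpM2r// h.
Qed.

(* Following the inward-transversal field outwards reaches the boundary after
   a time at most [|rho x| / c], which turns bounds along rays into bounds
   linear in [|rho|]. *)
Lemma ray_exit x v (c d : R) : 0 < c -> 0 < d -> Om x -> - rho x < c * d ->
  (forall s, `|s| <= d -> c <= 'D_v rho (x + s *: v)) ->
  exists s, [/\ 0 < s <= d, c * s <= - rho x, rho (x + s *: v) = 0 &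
    forall s', 0 <= s' < s -> Om (x + s' *: v)].
Proof.
move=> c0 d0 Ox rd h.
have h' s : 0 <= s <= d -> c <= 'D_v rho (x + s *: v).
  by move=> /andP[s0 sd]; apply: h; rewrite ger0_norm.
have Rx : rho x < 0 by exact/Om_rho.
have cont : {within `[0, d], continuous (fun s : R => rho (x + s *: v))}.
  apply: derivable_within_continuous => s _.
  by case: (is_derive_line (diff_derivable (v := v) (drho (x + s *: v)))).
have Rd : 0 <= rho (x + d *: v).
  have := rho_ray (ltW d0) h'; lra.
have [|s] := IVT (v := 0) (ltW d0) cont.
  by rewrite scale0r addr0 ge_min le_max (ltW Rx) Rd orbT.
rewrite in_itv/= => /andP[s0 sd] rs.
have ss : 0 < s.
  rewrite lt_neqAle s0 andbT; apply/eqP => e.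
  by move: rs Rx; rewrite -e scale0r addr0 => ->; rewrite ltxx.
exists s; split=> //; first by rewrite ss.
  have := @rho_ray x v c s s0; rewrite rs sub0r; apply => s' /andP[s'0 s's].
  by apply: h'; rewrite s'0 (le_trans s's).
move=> s' /andP[s'0 s's]; apply/Om_rho.
have s's0 : 0 <= s - s' by rewrite subr_ge0 ltW.
have := @rho_ray (x + s' *: v) v c (s - s') s's0.
rewrite -addrA -scalerDl [s' + _]addrC subrK rs => hh.
have /hh : forall t, 0 <= t <= s - s' -> c <= 'D_v rho (x + s' *: v + t *: v).
  move=> t /andP[t0 ts]; rewrite -addrA -scalerDl; apply: h'.
  by rewrite addr_ge0//=; lra.
have : 0 < c * (s - s') by rewrite mulr_gt0// subr_gt0.
lra.
Qed.

Lemma ray_exit_closure x v (s : R) : 0 < s ->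
  (forall s', 0 <= s' < s -> Om (x + s' *: v)) -> closure Om (x + s *: v).
Proof.
move=> s0 h B nB.
have cl : {for s, continuous (fun t : R => x + t *: v)}.
  have d : derivable (fun t : R => x + t *: v) s 1.
    by apply: derivableD; [exact: derivable_cst|apply: diff_derivable].
  exact/differentiable_continuous/derivable1_diffP.
have nB' : \forall t \near s^'-, B (x + t *: v) by exact: (cvg_at_left_filter cl nB).
have [t [[Bt t0] ts]] :=
  filter_ex (filterI (filterI nB' (nbhs_left_gt s0)) (nbhs_left_lt s)).
exists (x + t *: v); split=> //; apply: h.
by rewrite (ltW t0).
Qed.

(** Differentiability in the full space, also at boundary points; it is available because the fields
    are smooth on a neighbourhood of the closure. *)
Definition C1_closure f := (forall x, closure Om x -> differentiable f x) /\
  forall v x, closure Om x -> {for x, continuous (fun y => 'D_v f y)}.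

(** Compactness turns local constants into a global one. The local property is asked for all
    [C >= C0], so that a single constant near infinity serves everywhere. *)
Lemma cover_pinfty (P : R -> 'rV[R]_D -> Prop) :
  (forall p, closure Om p -> exists C0, \forall x \near p,
     forall C, C0 <= C -> P C x) ->
  exists2 C, 0 <= C & forall x, closure Om x -> P C x.
Proof.
move=> hP; have /compact_near_coveringP cov := compact_closure.
have {}cov : \forall C \near +oo, closure Om `<=` P C.
  apply: cov => p /hP[C0 hC0].
  exists ([set x | forall C, C0 <= C -> P C x], [set C | C0 <= C]) => /=.
    by split=> //; apply: nbhs_pinfty_ge; rewrite num_real.
  by move=> [x C] /= [h ?]; exact: h.
have c0 : \forall C \near +oo, (0 : R) <= C by apply: nbhs_pinfty_ge; rewrite num_real.
have [C [c1 c2]] := filter_ex (filterI c0 cov).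
by exists C.
Qed.

(** Near a boundary point, [ray_exit] joins [x] to a zero of [f] in a time at most [|rho x| / c],
    during which [f] changes at rate at most [B]; this gives the constant [B / c]. Near an interior
    point [|rho|] is bounded below and [f] is bounded. *)
Lemma vanish_linearly f : C1_closure f ->
  (forall x, closure Om x -> rho x = 0 -> f x = 0) ->
  exists2 C, 0 <= C & forall x, Om x -> `|f x| <= C * `|rho x|.
Proof.
move=> [df cdf] f0.
have [|C C0 h] := @cover_pinfty (fun C x => Om x -> `|f x| <= C * `|rho x|); last first.
  by exists C => // x Ox; apply: h => //; exact: subset_closure.
move=> p clp; have := closure_rho clp; rewrite le_eqVlt => /predU1P[p0|pneg].
  have [v [c [d [c0 d0 near_p]]]] := boundary_chart p0.
  have [B B0 hB] := bdd_closure (cdf v).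
  exists (B / c).
  have : \forall x \near p, - rho x < c * d.
    have cN : {for p, continuous (fun y => - rho y)} by apply: cont_atN; exact: crho.
    by apply: (cvgr_lt _ cN); rewrite p0 oppr0 mulr_gt0.
  apply: filterS2 near_p => x hx rx C BC Ox.
  have [s [/andP[s0 sd] cs rs Os]] := ray_exit c0 d0 Ox rx hx.
  have cls s' : 0 <= s' <= s -> closure Om (x + s' *: v).
    move=> /andP[s'0]; rewrite le_eqVlt => /predU1P[->|s's].
      exact: ray_exit_closure.
    by apply/subset_closure/Os; rewrite s'0.
  have [s' s's e] := @MVT_line R _ f x v s (ltW s0)
    (fun s' h => diff_derivable (v := v) (df _ (cls _ h))).
  move: e; rewrite (f0 (x + s *: v))//; last by apply: cls; rewrite lexx ltW.
  rewrite sub0r => e; rewrite -normrN e normrM (ger0_norm (ltW s0)).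
  apply: le_trans (_ : B * s <= _); first by rewrite ler_wpM2r ?(ltW s0)//; apply: hB; exact: cls.
  have Rx : rho x < 0 by exact/Om_rho.
  rewrite ltr0_norm//; apply: le_trans (_ : B / c * - rho x <= _); last first.
    by rewrite ler_wpM2r// oppr_ge0 ltW.
  by rewrite -mulrA ler_wpM2l// mulrC ler_pdivlMr// mulrC.
have cp : {for p, continuous f} by exact/differentiable_continuous/df.
exists ((`|f p| + 1) / (- rho p / 2)).
have h1 : \forall x \near p, `|f x| <= `|f p| + 1.
  by apply: (cvgr_le _ (cvg_norm cp)); rewrite ltrDl.
have h2 : \forall x \near p, rho x <= rho p / 2.
  by apply: (cvgr_le _ (@crho p)); lra.
apply: filterS2 h1 h2 => x h1 h2 C hC Ox.
have q0 : 0 < - rho p / 2 by rewrite divr_gt0// oppr_gt0.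
have rx : - rho p / 2 <= `|rho x| by rewrite -normrN ger0_norm; lra.
apply: le_trans h1 _.
apply: le_trans (_ : (`|f p| + 1) / (- rho p / 2) * (- rho p / 2) <= _).
  by rewrite divfK// gt_eqF.
by rewrite ler_pM// ?ltW// divr_gt0// ltr_wpDl.
Qed.

(** Meant for [varphi], whose behaviour at the boundary is not prescribed. As [Om] need not be
    convex, the mean value theorem is used along short rays only: a point near a boundary point [p]
    is joined, backwards along [v], to a point near [z = p - d *: v], which lies inside [Om]. *)
Lemma grad_bounded_bdd_cont f : (forall x, Om x -> differentiable f x) ->
  (forall v, exists C, forall x, Om x -> `|'D_v f x| <= C) -> bdd_cont f.
Proof.
move=> df bdf; split=> [x Ox|]; first exact/differentiable_continuous/df.
have cf x : Om x -> {for x, continuous f}.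
  by move=> Ox; exact/differentiable_continuous/df.
have bnear x : Om x -> \forall y \near x, `|f y| <= `|f x| + 1.
  by move=> /cf cx; apply: (cvgr_le _ (cvg_norm cx)); rewrite ltrDl.
have [|C C0 h] := @cover_pinfty (fun C x => Om x -> `|f x| <= C); last first.
  by exists C => x Ox; apply: h => //; exact: subset_closure.
move=> p clp; have := closure_rho clp; rewrite le_eqVlt => /predU1P[p0|pneg]; last first.
  have Op : Om p by exact/Om_rho.
  exists (`|f p| + 1); apply: filterS (bnear p Op) => x hx C hC _.
  exact: le_trans hx hC.
have [v [c [d [c0 d0 near_p]]]] := boundary_chart p0.
have [B hB] := bdf v.
pose z := p - d *: v.
have ray x : (forall s, `|s| <= d -> c <= 'D_v rho (x + s *: v)) -> forall s,
    0 <= s <= d -> rho (x - s *: v) + c * s <= rho x.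
  move=> hx s /andP[s0 sd]; have := @rho_ray (x - s *: v) v c s s0.
  rewrite subrK => hh; rewrite addrC -lerBrDr; apply: hh => t /andP[t0 ts].
  by rewrite -addrA -scaleNr -scalerDl; apply: hx; rewrite ler_norml; apply/andP; split; lra.
have Oz : Om z.
  apply/Om_rho; have := ray p (nbhs_singleton near_p) d.
  rewrite (ltW d0) lexx p0 => /(_ isT); rewrite /z.
  have : 0 < c * d by rewrite mulr_gt0.
  lra.
exists (`|f z| + 1 + `|B| * d).
have near_z : \forall x \near p, `|f (x - d *: v)| <= `|f z| + 1.
  have ct : (x - d *: v) @[x --> p] --> z.
    by apply: (@cvgB _ _ _ (nbhs p)); [exact: cvg_id|exact: cvg_cst].
  exact: ct _ (bnear z Oz).
apply: filterS2 near_p near_z => x hx hz C hC Ox; apply: le_trans hC.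
have Or s : 0 <= s <= d -> Om (x - d *: v + s *: v).
  move=> /andP[s0 sd]; apply/Om_rho.
  have := ray x hx (d - s).
  have -> : x - (d - s) *: v = x - d *: v + s *: v.
    by rewrite scalerBl opprB addrA addrAC.
  have Rx : rho x < 0 by exact/Om_rho.
  have e1 : 0 <= d - s <= d by apply/andP; split; lra.
  move=> /(_ e1); have : 0 <= c * (d - s) by rewrite mulr_ge0 ?subr_ge0 ?(ltW c0).
  lra.
have [s ss] := @MVT_line R _ f (x - d *: v) v d (ltW d0)
  (fun s h => diff_derivable (v := v) (df _ (Or s h))).
rewrite subrK => /eqP; rewrite subr_eq => /eqP ->.
rewrite addrC; apply: le_trans (ler_normD _ _) _; rewrite lerD//.
rewrite normrM (ger0_norm (ltW d0)) ler_wpM2r ?(ltW d0)//.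
by apply: le_trans (ler_norm B); apply: hB; exact: Or.
Qed.

(** * Integration by parts and differentiation under the integral sign *)

Lemma C1_closure_bdd_cont f : C1_closure f -> bdd_cont f.
Proof. by move=> [df _]; apply: bdd_cont_closure => x /df/differentiable_continuous. Qed.

Lemma C1_closure_bdd_cont_pd f j : C1_closure f -> bdd_cont (pd j f).
Proof. by move=> [_ cf]; apply: bdd_cont_closure; exact: cf. Qed.

(** [J_div] for the field whose only nonzero component is [f * g] in position [j]. Its flux is
    [O(|rho|)] because [f] vanishes linearly at the boundary, while [g] need only be bounded. *)
Lemma J_ibp f g j : C1_closure f ->
  (forall x, closure Om x -> rho x = 0 -> f x = 0) ->
  bdd_cont g -> (forall x, Om x -> derivable g x (ev R j)) ->
  bdd_cont (pd j g) ->
  J (fun x => pd j f x * g x) = - J (fun x => f x * pd j g x).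
Proof.
move=> cf f0 ng dg ndg.
have nf := C1_closure_bdd_cont cf; have ndf := C1_closure_bdd_cont_pd j cf.
have df x : Om x -> derivable f x (ev R j).
  by move=> Ox; apply/diff_derivable/(proj1 cf)/subset_closure.
pose F i x := if i == j then f x * g x else 0.
have pdF i x : Om x -> pd i (F i) x =
    if i == j then pd j f x * g x + f x * pd j g x else 0.
  move=> Ox; rewrite /F; case: eqP => [->|_]; last exact: derive_cst.
  rewrite /pd deriveM; [|exact: df|exact: dg].
  by rewrite /GRing.scale/= addrC mulrC.
have nfg : bdd_cont (fun x => pd j f x * g x + f x * pd j g x).
  by apply: bdd_contD; exact: bdd_contM.
have nr : bdd_cont (pd j rho) by apply: bdd_cont_closure => x _; exact: cdrho.
have [C C0 hC] := vanish_linearly cf f0.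
have [Cg Cg0 hg] := bdd_cont_ge0 ng.
have [Cr Cr0 hr] := bdd_cont_ge0 nr.
apply/eqP; rewrite -addr_eq0 -J_D; [|exact: bdd_contM..].
rewrite -(@J_div F (C * Cg * Cr)).
- apply/eqP/J_ext => x Ox; rewrite (bigD1 j)//= pdF// eqxx big1 ?addr0// => i ij.
  by rewrite pdF// (negbTE ij).
- move=> i; rewrite /F; case: eqP => _; [exact: bdd_contM|exact: bdd_cont_cst].
- move=> i x Ox; rewrite /F; case: eqP => [->|_]; last exact: derivable_cst.
  by apply: derivableM; [exact: df|exact: dg].
- move=> i; apply: bdd_cont_ext (fun x Ox => esym (pdF i x Ox)) _.
  by case: eqP => _; [|exact: bdd_cont_cst].
- by rewrite !mulr_ge0.
- move=> x Ox; rewrite (bigD1 j)//= /F eqxx big1 ?addr0 => [|i /negbTE->]; last by rewrite mul0r.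
  rewrite [leRHS](_ : _ = C * `|rho x| * Cg * Cr); last by ring.
  by rewrite !normrM ler_pM ?mulr_ge0 ?hr// ler_pM ?hg ?hC.
Qed.

(** By compactness [F' s] is uniformly close to [F' t] on the closure for [s] near [t]; the mean
    value theorem in time then bounds the first-order remainder uniformly in [x], and so its
    integral. *)
Lemma J_derive (F F' : R -> 'rV[R]_D -> R) (t : R) :
  (forall x, closure Om x -> \forall p \near (t, x),
     is_derive (p.1 : R) (1 : R) (fun s : R => F s p.2) (F' p.1 p.2) /\
     {for p.2, continuous (F p.1)}) ->
  (forall x, closure Om x -> {for (t, x), continuous (fun p => F' p.1 p.2)}) ->
  is_derive t 1 (fun s => J (F s)) (J (F' t)).
Proof.
move=> dF cF'.
have cover (P : R -> 'rV[R]_D -> Prop) :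
    (forall x, closure Om x -> \forall p \near (t, x), P p.1 p.2) ->
    \forall s \near t, forall x, closure Om x -> P s x.
  move=> hP; have /compact_near_coveringP cov := compact_closure.
  apply: (cov _ (nbhs t) P) => x /hP.
  move=> [[A B] /= [nA nB] AB]; exists (B, A) => //= -[y s] [/= By As].
  exact: (AB (s, y)).
have cF't x : closure Om x -> {for x, continuous (F' t)}.
  move=> clx; apply: (cvg_comp (fun y => (t, y)) (fun p => F' p.1 p.2) _ (cF' x clx)).
  apply: (@cvg_pair _ _ _ (nbhs x) (nbhs t) (nbhs x)); first exact: cvg_cst.
  exact: cvg_id.
have nF't := bdd_cont_closure cF't.
have covF := cover (fun s x => is_derive s (1 : R) (F ^~ x) (F' s x) /\
  {for x, continuous (F s)}) dF.
apply: is_derive_first_order => e e0.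
pose K := (2 * M) ^+ D + 1.
have K0 : 0 < K by rewrite ltr_wpDl// exprn_ge0// mulr_ge0.
have eK : 0 < e / K by rewrite divr_gt0.
have covF' : \forall s \near t, forall x, closure Om x ->
    `|F' t x - F' s x| <= e / K.
  apply: cover => x clx.
  have c1 := cF' x clx.
  have c2 : {for (t, x), continuous (fun p : R * 'rV[R]_D => F' t p.2)}.
    apply: (cvg_comp snd (F' t) _ (cF't x clx)).
    exact: (@cvg_snd _ _ (nbhs t) (nbhs x)).
  have c3 : {for (t, x), continuous (fun p => `|F' t p.2 - F' p.1 p.2|)}.
    apply: (@cont_at_comp _ _ (fun p => F' t p.2 - F' p.1 p.2) (fun r : R => `|r|)).
      by apply: cont_atD => //; exact: cont_atN.
    exact: norm_continuous.
  by apply: (cvgr_le _ c3); rewrite /= subrr normr0.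
have [d /= d0 hd] := iffLR (nbhs_ballP t _) (filterI covF covF').
have near0 : \forall h \near (0 : R), `|h| < d by exact: nbhs0_lt.
apply: filterS near0 => h hd'.
have inb s : 0 <= s <= 1 -> ball t d (t + s *: h).
  move=> /andP[s0 s1]; rewrite -ball_normE /= opprD addrA subrr add0r normrN.
  apply: le_lt_trans hd'; rewrite normrZ (ger0_norm s0).
  by rewrite ler_piMl.
have nF s : 0 <= s <= 1 -> bdd_cont (F (t + s *: h)).
  move=> /inb/hd[h1 _]; apply: bdd_cont_closure => x /h1[_]; exact.
have nFt : bdd_cont (F t).
  by have := nF 0; rewrite scale0r addr0 lexx ler01; apply.
have nFh : bdd_cont (F (h + t)).
  by have := nF 1; rewrite scale1r addrC lexx ler01; apply.
have -> : J (F (h + t)) - J (F t) - J (F' t) * h =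
    J (fun x => F (h + t) x + (- 1 * F t x + - h * F' t x)).
  rewrite J_D; [|by []|by apply: bdd_contD; exact: bdd_contZ].
  by rewrite J_D ?J_Z//; [ring|exact: bdd_contZ..].
apply: le_trans (_ : (e / K * `|h|) * (2 * M) ^+ D <= _).
  apply: J_norm_le.
  - by rewrite mulr_ge0// ltW.
  - by apply: bdd_contD => //; apply: bdd_contD; exact: bdd_contZ.
  move=> x Ox; have clx := subset_closure Ox.
  have dx s : 0 <= s <= 1 -> is_derive (t + s *: h) 1 (F ^~ x) (F' (t + s *: h) x).
    by move=> /inb/hd[/(_ x clx)[]].
  have dfx s : 0 <= s <= 1 -> differentiable (F ^~ x) (t + s *: h).
    by move=> /dx[? _]; apply/derivable1_diffP.
  (* The segment is run over [[0, 1]] in direction [h], so both signs of [h] are treated at once. *)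
  have [s ss] := @MVT_line R _ (F ^~ x) t h 1 ler01
    (fun s hs => diff_derivable (v := h) (dfx s hs)).
  have -> : 'D_h (F ^~ x) (t + s *: h) = h * F' (t + s *: h) x.
    have hE : h = h *: (1 : R) by rewrite /GRing.scale/= mulr1.
    transitivity ('D_(h *: (1 : R)) (F ^~ x) (t + s *: h)); first by rewrite -hE.
    rewrite derive_scale; last exact: dfx.
    by have [_ ->] := dx s ss.
  rewrite mulr1 scale1r [t + h]addrC => e1.
  have -> : F (h + t) x + (-1 * F t x + - h * F' t x) =
      - (h * (F' t x - F' (t + s *: h) x)).
    have -> : F (h + t) x = F t x + h * F' (t + s *: h) x by rewrite -e1; ring.
    by ring.
  rewrite normrN normrM mulrC ler_wpM2r//.
  by have [_ /(_ x clx)] := hd _ (inb s ss).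
rewrite mulrAC ler_wpM2r// mulrAC ler_pdivrMr// ler_pM2l// lerDl//.
Qed.

(** * Smooth fields; uniqueness for the heat equation and the Neumann problem *)

Lemma smooth_C1 (V : set 'rV[R]_D) f : closure Om `<=` V -> smooth_on V f ->
  C1_closure f.
Proof.
move=> cV sf; split=> [x /cV|v x /cV]; first exact: smooth_diff.
by apply: smooth_cont; exact: smooth_derive.
Qed.

Lemma smooth_bdd (V : set 'rV[R]_D) f : closure Om `<=` V -> smooth_on V f ->
  bdd_cont f.
Proof. by move=> cV sf; exact/C1_closure_bdd_cont/(smooth_C1 cV). Qed.

Lemma J_derive_smooth (U : set (R * 'rV[R]_D)) (f : R * 'rV[R]_D -> R) (t : R) :
  open U -> smooth_on U f -> (forall x, closure Om x -> U (t, x)) ->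
  is_derive t 1 (fun s => J (fun x => f (s, x))) (J (fun x => dt f (t, x))).
Proof.
move=> oU sf cU.
apply: (@J_derive (fun s x => f (s, x)) (fun s x => dt f (s, x))) => x /cU Ux.
  have := open_nbhs_nbhs (conj oU Ux); apply: filterS => -[s y] Usy /=; split.
    exact/is_derive_time/(smooth_derivable sf Usy).
  exact: (smooth_cont (smooth_slice s sf)).
have -> : (fun p : R * 'rV[R]_D => dt f (p.1, p.2)) = dt f by apply/funext => -[].
exact: (smooth_cont (smooth_dt sf)).
Qed.

Lemma J_sqr_ge0 f : 0 <= J (fun x => f x * f x).
Proof. by apply: J_ge0 => x _; rewrite -expr2 sqr_ge0. Qed.

(** The integral [E] of [H^2] satisfies [E' = - 2 nu sum_k int (dx k H)^2 <= 0]; the integration by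
    parts is allowed by the Dirichlet condition, and [E] starts at zero. *)
Lemma heat_zero (U : set (R * 'rV[R]_D)) (H : R * 'rV[R]_D -> R) (a b nu : R) :
  open U -> smooth_on U H -> 0 <= nu ->
  (forall t x, a <= t <= b -> closure Om x -> U (t, x)) ->
  (forall t x, a <= t <= b -> Om x ->
     dt H (t, x) = nu * \sum_k dx k (dx k H) (t, x)) ->
  (forall t x, a <= t <= b -> closure Om x -> rho x = 0 -> H (t, x) = 0) ->
  (forall x, Om x -> H (a, x) = 0) ->
  forall t x, a <= t <= b -> Om x -> H (t, x) = 0.
Proof.
move=> oU sH nu0 cU heat bH H0 t x tab Ox.
pose E s := J (fun x => H (s, x) * H (s, x)).
have sH2 := smoothM oU sH sH.
have cUs s : a <= s <= b -> closure Om `<=` tslice U s by move=> sab y; exact: cU.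
have nH s : a <= s <= b -> bdd_cont (fun x => H (s, x)).
  by move=> sab; exact: smooth_bdd (cUs s sab) (smooth_slice s sH).
have dE s : a <= s <= b -> is_derive s 1 E (J (fun x => dt (fun p => H p * H p) (s, x))).
  by move=> sab; apply: J_derive_smooth oU sH2 _ => y; exact: cU.
have E0 s : a <= s <= b -> E s = 0.
  apply: decay_zero dE _ _ _ s => [s sab||s _]; last exact: J_sqr_ge0.
    have sHs := smooth_slice s sH; have cs := cUs s sab.
    have pdE k : pd k (fun x => H (s, x)) = (fun x => dx k H (s, x)).
      by apply/funext => y; rewrite pd_slice.
    have pd2E k : pd k (fun x => dx k H (s, x)) = (fun x => dx k (dx k H) (s, x)).
      by apply/funext => y; rewrite pd_slice.
    have sdx k := smooth_slice s (smooth_dx k sH).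
    have sddx k := smooth_slice s (smooth_dx k (smooth_dx k sH)).
    have ndx k := smooth_bdd cs (sdx k).
    have nddx k := smooth_bdd cs (sddx k).
    have nHs := nH s sab.
    rewrite (_ : J _ = 2 * nu *
        \sum_k J (fun x => H (s, x) * dx k (dx k H) (s, x))); last first.
      rewrite -J_sum => [|k]; last exact: bdd_contM.
      rewrite -J_Z; last by apply: bdd_cont_sum => k; exact: bdd_contM.
      apply: J_ext => y Oy; have Uy := cU s y sab (subset_closure Oy).
      have dH := smooth_derivable (v := ((1, 0) : R * 'rV[R]_D)) sH Uy.
      rewrite /dt deriveM// -/(dt H (s, y)) heat// -mulr_sumr.
      by rewrite /GRing.scale/=; ring.
    rewrite mulr_ge0_le0 ?mulr_ge0// sumr_le0// => k _; rewrite -oppr_ge0.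
    have := @J_ibp (fun x => H (s, x)) (fun x => dx k H (s, x)) k
      (smooth_C1 cs sHs) (bH s ^~ sab) (ndx k).
    rewrite pdE pd2E => /(_ _ (nddx k)) <-; last first.
      by move=> y Oy; apply: (smooth_derivable (sdx k)); exact/cs/subset_closure.
    exact: J_sqr_ge0.
  by rewrite /E -[RHS]J_0; apply: J_ext => y Oy; rewrite H0// mulr0.
have H2 := J_eq0 (bdd_contM (nH t tab) (nH t tab)) _ (E0 t tab) Ox.
by apply/eqP; rewrite -sqrf_eq0 expr2 H2// => y _; rewrite -expr2 sqr_ge0.
Qed.

Lemma sum_sqr_eq0 (f : 'I_D -> R) : \sum_j f j * f j = 0 -> forall j, f j = 0.
Proof.
move=> /eqP; rewrite psumr_eq0 => [/allP h j|j _]; last by rewrite -expr2 sqr_ge0.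
by have := h j (mem_index_enum j); rewrite /= mulf_eq0 orbb => /eqP.
Qed.

Hypothesis srho : smooth_on setT rho.

(** [J_div] for the field [phi grad phi], whose divergence is [|grad phi|^2] as [phi] is harmonic.
    [J_ibp] does not apply since [phi] need not vanish on the boundary; it is [grad phi . grad rho]
    that vanishes there, hence linearly in [rho]. *)
Lemma neumann_zero (V : set 'rV[R]_D) phi : open V -> closure Om `<=` V ->
  smooth_on V phi -> (forall x, Om x -> \sum_j pd j (pd j phi) x = 0) ->
  (forall x, closure Om x -> rho x = 0 ->
     \sum_j pd j phi x * pd j rho x = 0) ->
  forall x j, Om x -> pd j phi x = 0.
Proof.
move=> oV cV sp lp bp x j Ox.
have srV := smooth_sub (subsetT V) srho.
have sd k : smooth_on V (pd k phi) by exact: smooth_derive.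
have sdd k : smooth_on V (pd k (pd k phi)) by exact: smooth_derive.
have sG : smooth_on V (fun x => \sum_k pd k phi x * pd k rho x).
  by apply: smooth_sum => // k; apply: smoothM => //; exact: smooth_derive.
have [C C0 hC] := vanish_linearly (smooth_C1 cV sG) bp.
have nphi := smooth_bdd cV sp.
have [B B0 hB] := bdd_cont_ge0 nphi.
have nd k := smooth_bdd cV (sd k); have ndd k := smooth_bdd cV (sdd k).
have VO y : Om y -> V y by move=> /subset_closure/cV.
pose F k y := phi y * pd k phi y.
have pdF k y : Om y -> pd k (F k) y = pd k phi y * pd k phi y + phi y * pd k (pd k phi) y.
  move=> Oy; rewrite {1}/pd deriveM; [|exact: smooth_derivable sp (VO _ Oy)|].
    by rewrite /GRing.scale/= addrC.
  exact: smooth_derivable (sd k) (VO _ Oy).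
have nF k : bdd_cont (F k) by exact: bdd_contM.
have npdF k : bdd_cont (pd k (F k)).
  apply: bdd_cont_ext (fun y Oy => esym (pdF k y Oy)) _.
  by apply: bdd_contD; exact: bdd_contM.
have := @J_div F (B * C) nF _ npdF _ _.
rewrite (@J_ext _ (fun y => \sum_k pd k phi y * pd k phi y)); last first.
  move=> y Oy; rewrite (eq_bigr _ (fun k _ => pdF k y Oy)) big_split/=.
  by rewrite -mulr_sumr lp// mulr0 addr0.
move=> h; apply: (@sum_sqr_eq0 (fun j => pd j phi x)).
have ns : bdd_cont (fun y => \sum_k pd k phi y * pd k phi y).
  by apply: bdd_cont_sum => k; exact: bdd_contM.
apply: (J_eq0 ns) Ox => [y _|].
  by apply: sumr_ge0 => k _; rewrite -expr2 sqr_ge0.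
apply: h.
- move=> k y Oy; apply: derivableM; first exact: smooth_derivable sp (VO _ Oy).
  exact: smooth_derivable (sd k) (VO _ Oy).
- exact: mulr_ge0.
- move=> y Oy; rewrite (_ : flux F y = phi y * \sum_k pd k phi y * pd k rho y).
    by rewrite normrM -mulrA ler_pM ?hB ?hC.
  by rewrite mulr_sumr; apply: eq_bigr => k _; rewrite /F mulrA.
Qed.

(** * Energy integrals of a divergence-free field that vanishes on the boundary *)

Section NoSlip.
Variables (V : set 'rV[R]_D) (u : 'I_D -> 'rV[R]_D -> R).
Hypotheses (oV : open V) (cV : closure Om `<=` V)
  (su : forall i, smooth_on V (u i))
  (bu : forall i x, closure Om x -> rho x = 0 -> u i x = 0)
  (divu : forall x, Om x -> \sum_j pd j (u j) x = 0).

(** In this section [nu] is not the viscosity but the regularity of [u]. *)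
Let nu i : bdd_cont (u i).
Proof. exact: smooth_bdd cV (su i). Qed.

Let ndu i j : bdd_cont (pd j (u i)).
Proof. exact: smooth_bdd cV (smooth_derive _ (su i)). Qed.

Let VO y : Om y -> V y.
Proof. by move=> /subset_closure/cV. Qed.

(** Orthogonality of solenoidal fields and gradients. The derivatives fall on [u], which vanishes at
    the boundary, so [p] needs no boundary values and may be [varphi] as well as the pressure. *)
Lemma J_grad p : bdd_cont p -> (forall x j, Om x -> derivable p x (ev R j)) ->
  (forall j, bdd_cont (pd j p)) -> J (fun x => \sum_j u j x * pd j p x) = 0.
Proof.
move=> np dp ndp; rewrite J_sum => [|j]; last exact: bdd_contM.
rewrite (eq_bigr (fun j => - J (fun x => pd j (u j) x * p x))) => [|j _]; last first.
  rewrite (@J_ibp (u j) p j) ?opprK//; first exact: smooth_C1 cV (su j).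
    exact: bu.
  by move=> x; exact: dp.
rewrite sumrN -J_sum => [|j]; last exact: bdd_contM.
rewrite (@J_ext _ (fun=> 0)) ?J_0 ?oppr0// => x Ox.
by rewrite -mulr_suml divu// mul0r.
Qed.

(** Integrating the [j]-th term by parts reproduces it with the opposite sign, plus a term in
    [pd j (u j)]; so twice the sum over [j] is minus the integral of [u i ^+ 2] times the
    divergence. The cancellation holds for each component [i] separately. *)
Lemma J_adv i : J (fun x => u i x * \sum_j u j x * pd j (u i) x) = 0.
Proof.
pose K j := J (fun x => u i x * (u j x * pd j (u i) x)).
rewrite (@J_ext _ (fun x => \sum_j u i x * (u j x * pd j (u i) x))); last first.
  by move=> x _; rewrite mulr_sumr.
rewrite J_sum => [|j]; last by apply: bdd_contM => //; exact: bdd_contM.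
have pdM j x : Om x -> pd j (fun y => u i y * u j y) x =
    u i x * pd j (u j) x + u j x * pd j (u i) x.
  move=> /VO Vx; rewrite {1}/pd deriveM//; exact: smooth_derivable (su _) Vx.
have n1 j : bdd_cont (fun x => u i x * (u i x * pd j (u j) x)).
  by apply: bdd_contM => //; exact: bdd_contM.
have n2 j : bdd_cont (fun x => u i x * (u j x * pd j (u i) x)).
  by apply: bdd_contM => //; exact: bdd_contM.
have K2 j : 2 * K j = - J (fun x => u i x * (u i x * pd j (u j) x)).
  have := @J_ibp (u i) (fun y => u i y * u j y) j (smooth_C1 cV (su i)) (@bu i)
    (bdd_contM (nu i) (nu j)).
  rewrite (@J_ext _ (fun x => u i x * (u j x * pd j (u i) x))); last first.
    by move=> x _; ring.
  rewrite (@J_ext (fun x => u i x * pd j (fun y => u i y * u j y) x)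
    (fun x => u i x * (u i x * pd j (u j) x) + u i x * (u j x * pd j (u i) x))); last first.
    by move=> x Ox; rewrite pdM// mulrDr.
  rewrite J_D// -/(K j) => h.
  have : K j = - (J (fun x => u i x * (u i x * pd j (u j) x)) + K j).
    apply: h => [x /VO Vx|].
      by apply: derivableM; exact: smooth_derivable (su _) Vx.
    apply: bdd_cont_ext (fun x Ox => esym (pdM j x Ox)) _.
    by apply: bdd_contD; exact: bdd_contM.
  lra.
have : 2 * \sum_j K j = 0.
  rewrite mulr_sumr (eq_bigr _ (fun j _ => K2 j)) sumrN -J_sum//.
  rewrite (@J_ext _ (fun=> 0)) ?J_0 ?oppr0// => x Ox.
  by rewrite -!mulr_sumr divu// !mulr0.
by move=> /eqP; rewrite mulf_eq0 pnatr_eq0/= => /eqP.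
Qed.

Lemma J_lap i : J (fun x => u i x * \sum_j pd j (pd j (u i)) x) =
  - J (fun x => \sum_j pd j (u i) x ^+ 2).
Proof.
have nddu j : bdd_cont (pd j (pd j (u i))).
  exact: smooth_bdd cV (smooth_derive _ (smooth_derive _ (su i))).
rewrite (@J_ext _ (fun x => \sum_j u i x * pd j (pd j (u i)) x)); last first.
  by move=> x _; rewrite mulr_sumr.
rewrite (@J_ext (fun x => \sum_j pd j (u i) x ^+ 2)
  (fun x => \sum_j pd j (u i) x * pd j (u i) x))//.
rewrite !J_sum => [|j|j]; try exact: bdd_contM.
rewrite -sumrN; apply: eq_bigr => j _.
rewrite (@J_ibp (u i) (pd j (u i)) j) ?opprK//; first exact: smooth_C1 cV (su i).
  exact: bu.
by move=> x /VO Vx; exact: smooth_derivable (smooth_derive _ (su i)) Vx.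
Qed.
End NoSlip.

(** * The GePUP-E system *)

Lemma bdryE x : bdry Om x <-> closure Om x /\ rho x = 0.
Proof.
rewrite /bdry (proj1 (interior_id Om) openOm); split=> [[clx nOx]|[clx r0]].
  split=> //; apply/eqP; rewrite eq_le closure_rho//= leNgt; apply/negP.
  by move=> /Om_rho.
by split=> // /Om_rho; rewrite r0 ltxx.
Qed.

(** Conditions on the unit normal become conditions on [grad rho], which is smooth and does not
    involve the square root. *)
Lemma normal_dot x : rho x = 0 -> exists2 c, c != 0 & forall v,
  dot (normal rho x) v = c * \sum_j pd j rho x * v 0 j.
Proof.
move=> r0; exists (Num.sqrt (dot (grad rho x) (grad rho x)))^-1.
  rewrite invr_neq0// gt_eqF// sqrtr_gt0 lt_neqAle eq_sym.
  have s0 : 0 <= dot (grad rho x) (grad rho x).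
    by apply: sumr_ge0 => j _; rewrite -expr2 sqr_ge0.
  rewrite s0 andbT; apply: contra (grho r0) => /eqP h.
  by apply/eqP/rowP => j; rewrite (@sum_sqr_eq0 (fun j => grad rho x 0 j) h) mxE.
move=> v; rewrite mulr_sumr; apply: eq_bigr => j _.
by rewrite /normal /grad !mxE mulrA.
Qed.

Lemma dotC (a b : 'rV[R]_D) : dot a b = dot b a.
Proof. by apply: eq_bigr => j _; exact: mulrC. Qed.

Section Solution.
Notation X := (R * 'rV[R]_D)%type.
Variables (nu lambda t0 T : R) (U : set X)
  (g w u : R -> 'rV[R]_D -> 'rV[R]_D) (q varphi : R -> 'rV[R]_D -> R).
Hypotheses (nu0 : 0 <= nu) (lambda0 : 0 <= lambda) (t0T : t0 < T) (oU : open U).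
Hypothesis cU : forall t x, t0 <= t <= T -> closure Om x -> U (t, x).

Definition coordf (v : R -> 'rV[R]_D -> 'rV[R]_D) (i : 'I_D) (p : X) : R :=
  v p.1 p.2 0 i.
Local Notation W := (coordf w).
Local Notation Uc := (coordf u).
Local Notation G := (coordf g).
Local Notation Q := (fun p : X => q p.1 p.2).

Hypotheses (sW : forall i, smooth_on U (W i)) (sU : forall i, smooth_on U (Uc i))
  (sG : forall i, smooth_on U (G i)) (sQ : smooth_on U Q).
Hypothesis conservative : forall t x, t0 <= t <= T -> Om x ->
  differentiable (varphi t) x /\ g t x = - grad (varphi t) x.
Hypothesis momentum : forall t x, t0 <= t <= T -> Om x ->
  'D_1 (fun s => w s x) t
    = g t x - adv (u t) x - grad (q t) x + nu *: lap (w t) x.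
Hypothesis bdry_w : forall t x, t0 <= t <= T -> bdry Om x ->
  (forall tau : 'rV[R]_D, dot tau (normal rho x) = 0 -> dot (w t x) tau = 0)
  /\ div (w t) x = 0.
Hypothesis projection : forall t, t0 <= t <= T ->
  exists phi : 'rV[R]_D -> R,
    [/\ exists V : set 'rV[R]_D,
          [/\ open V, closure Om `<=` V & smooth_on V phi],
        (forall x, Om x -> lap phi x = div (w t) x),
        (forall x, bdry Om x ->
           dot (normal rho x) (grad phi x) = dot (normal rho x) (w t x)) &
        (forall x, Om x -> u t x = w t x - grad phi x)].
Hypothesis bdry_u : forall t x, t0 <= t <= T -> bdry Om x ->
  dot (u t x) (normal rho x) = 0.
Hypothesis poisson : forall t x, t0 <= t <= T -> Om x ->
  lap (q t) x = div (fun y => g t y - adv (u t) y) x.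
Hypothesis bdry_q : forall t x, t0 <= t <= T -> bdry Om x ->
  dot (normal rho x) (grad (q t) x)
    = dot (normal rho x) (g t x - adv (u t) x + nu *: lap (w t) x)
      + lambda * dot (normal rho x) (w t x).
Hypothesis initial : forall x, closure Om x -> w t0 x = u t0 x.

(** * The system written in components on space-time *)

Let t0I : t0 <= t0 <= T.
Proof. by rewrite lexx ltW. Qed.

Let UO t x : t0 <= t <= T -> Om x -> U (t, x).
Proof. by move=> tI /subset_closure; exact: cU. Qed.

Let cUt t : t0 <= t <= T -> closure Om `<=` tslice U t.
Proof. by move=> tI x; exact: cU. Qed.

Let derivable_pd (v : R -> 'rV[R]_D -> 'rV[R]_D) t x i j :
  (forall i, smooth_on U (coordf v i)) -> U (t, x) ->
  derivable (fun y => v t y 0 i) x (ev R j).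
Proof. by move=> sv Utx; exact: smooth_derivable (smooth_slice t (sv i)) Utx. Qed.

Let pd_coordf (v : R -> 'rV[R]_D -> 'rV[R]_D) t i j :
  pd j (fun y => v t y 0 i) = (fun x => dx j (coordf v i) (t, x)).
Proof. by apply/funext => x; exact: (pd_slice (coordf v i)). Qed.

Let pd2_coordf (v : R -> 'rV[R]_D -> 'rV[R]_D) t i j x :
  pd j (pd j (fun y => v t y 0 i)) x = dx j (dx j (coordf v i)) (t, x).
Proof. by rewrite pd_coordf; exact: (pd_slice (dx j (coordf v i))). Qed.

Let div_coordf (v : R -> 'rV[R]_D -> 'rV[R]_D) t x :
  (forall i, smooth_on U (coordf v i)) -> U (t, x) ->
  div (v t) x = \sum_j dx j (coordf v j) (t, x).
Proof.
move=> sv Utx; rewrite div_coord => [|i j]; last exact: derivable_pd.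
by apply: eq_bigr => j _; rewrite pd_coordf.
Qed.

Definition advection i (p : X) : R := \sum_j Uc j p * dx j (Uc i) p.
Definition laplacian (f : X -> R) (p : X) : R := \sum_j dx j (dx j f) p.

Let adv_coordf t x i : U (t, x) -> adv (u t) x 0 i = advection i (t, x).
Proof.
move=> Utx; rewrite adv_coord => [|i' j]; last exact: derivable_pd.
by apply: eq_bigr => j _; rewrite pd_coordf.
Qed.

Let lap_coordf t x i : U (t, x) -> lap (w t) x 0 i = laplacian (W i) (t, x).
Proof.
move=> Utx.
have -> := @lap_coord R D (tslice U t) (w t) x i (tslice_open (t := t) oU)
  (fun j => smooth_slice t (sW j)) Utx.
by apply: eq_bigr => j _; rewrite pd2_coordf.
Qed.

Let grad_q t x i : grad (q t) x 0 i = dx i Q (t, x).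
Proof. by rewrite mxE; exact: (pd_slice Q). Qed.

Let pd2_q t x j : pd j (pd j (q t)) x = dx j (dx j Q) (t, x).
Proof.
have -> : pd j (q t) = (fun y => dx j Q (t, y)).
  by apply/funext => y; exact: (pd_slice Q).
exact: (pd_slice (dx j Q)).
Qed.

Let smooth_advection i : smooth_on U (advection i).
Proof. by apply: smooth_sum => // j; apply: smoothM => //; exact: smooth_dx. Qed.

Let smooth_laplacian (f : X -> R) : smooth_on U f -> smooth_on U (laplacian f).
Proof. by move=> sf; apply: smooth_sum => // j; exact/smooth_dx/smooth_dx. Qed.

(** Differences are written with a factor [-1] so that smoothness follows from sums and products. *)
Definition rhs i (p : X) : R :=
  G i p + (-1) * advection i p + (-1) * dx i Q p + nu * laplacian (W i) p.

Let smooth_rhs i : smooth_on U (rhs i).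
Proof.
apply: smoothD => //; last first.
  by apply: smoothM => //; [exact: smooth_cst|exact: smooth_laplacian].
apply: smoothD => //; last first.
  by apply: smoothM => //; [exact: smooth_cst|exact: smooth_dx].
by apply: smoothD => //; apply: smoothM => //; exact: smooth_cst.
Qed.

Let momentum_coord t x i : t0 <= t <= T -> Om x -> dt (W i) (t, x) = rhs i (t, x).
Proof.
move=> tI Ox; have Utx := UO tI Ox.
have h j := is_derive_time (smooth_derivable (v := ((1, 0) : X)) (sW j) Utx).
have e : ('D_1 (fun s => w s x) t) 0 i = dt (W i) (t, x).
  rewrite derive_coord; first exact: (derive_val (is_derive := h i)).
  by move=> j; exact: (ex_derive (is_derive := h j)).
rewrite -e momentum// !mxE adv_coordf// lap_coordf// -/(grad (q t) x).
have := grad_q t x i; rewrite mxE => ->.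
by rewrite /rhs /coordf /=; ring.
Qed.

Let momentum_closure t x i : t0 <= t <= T -> closure Om x ->
  dt (W i) (t, x) = rhs i (t, x).
Proof.
move=> tI; apply: (eq_closure (f := fun x => dt (W i) (t, x))
  (g := fun x => rhs i (t, x))) x => [x clx|x clx|x]; last exact: momentum_coord.
  exact: (smooth_cont (smooth_slice t (smooth_dt (sW i))) (cU tI clx)).
exact: (smooth_cont (smooth_slice t (smooth_rhs i)) (cU tI clx)).
Qed.

(** * Reduction to the no-slip Navier-Stokes equations *)

Let div_u t x : t0 <= t <= T -> Om x -> \sum_j dx j (Uc j) (t, x) = 0.
Proof.
move=> tI Ox; have [phi [[V [oV cV sp]] lp _ up]] := projection tI.
have Utx := UO tI Ox; have Vx : V x by exact/cV/subset_closure.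
have := lp x Ox; rewrite (div_coordf sW Utx) => lpx.
have e j : dx j (Uc j) (t, x) = dx j (W j) (t, x) - pd j (pd j phi) x.
  rewrite -(pd_slice (Uc j)) -(pd_slice (W j)).
  rewrite -(@deriveB _ _ _ (fun y => W j (t, y)) (pd j phi)).
  - apply: near_eq_derive; apply: filterS (Om_near Ox) => y Oy.
    by rewrite /coordf /= up// !mxE.
  - exact: smooth_derivable (smooth_slice t (sW j)) Utx.
  - exact: smooth_derivable (smooth_derive _ sp) Vx.
by rewrite (eq_bigr _ (fun j _ => e j)) sumrB -lpx subrr.
Qed.

Definition divergence (p : X) : R := \sum_j dx j (W j) p.

Let smooth_divergence : smooth_on U divergence.
Proof. by apply: smooth_sum => // j; exact: smooth_dx. Qed.

(** The divergence of the momentum equation: the Poisson equation cancels force, advection and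
    pressure, and the mixed derivatives commute. *)
Let divergence_heat t x : t0 <= t <= T -> Om x ->
  dt divergence (t, x) = nu * laplacian divergence (t, x).
Proof.
move=> tI Ox; have Utx := UO tI Ox.
have nU : \forall p \near ((t, x) : X), U p by exact: open_nbhs_nbhs.
(* By the momentum equation [B] equals [g - u . grad u] in [Om]; inserted in the Poisson equation,
   this form turns it into a relation between [w] and [q] alone. *)
pose B j (p : X) := dt (W j) p + dx j Q p + (- nu) * laplacian (W j) p.
have sB j : smooth_on U (B j).
  apply: smoothD => //.
    by apply: smoothD => //; [exact: smooth_dt|exact: smooth_dx].
  by apply: smoothM => //; [exact: smooth_cst|exact: smooth_laplacian].
have FB i y : Om y -> (g t y - adv (u t) y) 0 i = B i (t, y).
  move=> Oy; rewrite !mxE adv_coordf; last exact: UO.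
  by rewrite /B momentum_coord// /rhs /coordf /=; ring.
have nFB i : \forall y \near x, B i (t, y) = (g t y - adv (u t) y) 0 i.
  by apply: filterS (Om_near Ox) => y /FB.
have := poisson tI Ox; rewrite div_coord => [|i j]; last first.
  apply: (near_eq_derivable (nFB i)).
  exact: smooth_derivable (smooth_slice t (sB i)) Utx.
have -> : \sum_j pd j (fun y => (g t y - adv (u t) y) 0 j) x =
    \sum_j dx j (B j) (t, x).
  apply: eq_bigr => j _; rewrite -(pd_slice (B j)).
  by apply: near_eq_derive; apply: filterS (nFB j) => y ->.
have -> : lap (q t) x = laplacian Q (t, x).
  by rewrite /lap /laplacian; apply: eq_bigr => j _; exact: pd2_q.
have dB j : dx j (B j) (t, x) = dx j (dt (W j)) (t, x) + dx j (dx j Q) (t, x)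
    - nu * dx j (laplacian (W j)) (t, x).
  have d1 := smooth_derivable (v := (0, ev R j) : X) (smooth_dt (sW j)) Utx.
  have d2 := smooth_derivable (v := (0, ev R j) : X) (smooth_dx j sQ) Utx.
  have d3 := smooth_derivable (v := (0, ev R j) : X) (smooth_laplacian (sW j)) Utx.
  have h := is_deriveD (is_deriveD (derivableP d1) (derivableP d2))
    (is_deriveZ (- nu) (derivableP d3)).
  by rewrite /dx (derive_val (is_derive := h)) scaleNr.
have dsum (v : X) (r : 'I_D -> X -> R) : (forall j, smooth_on U (r j)) ->
    forall p, U p -> 'D_v (fun p => \sum_j r j p) p = \sum_j 'D_v (r j) p.
  move=> sr p Up; apply: (proj1 (derive_sumE _ _)) => j.
  exact: smooth_derivable (sr j) Up.
(* [L] is the Laplacian of [q], which occurs on both sides of the Poisson equation and drops out. *)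
have isolate (L A C : R) : L = A + L - C -> A = C by lra.
rewrite (eq_bigr _ (fun j _ => dB j)) sumrB big_split /= -mulr_sumr => /isolate pois.
have dt_div : dt divergence (t, x) = \sum_j dx j (dt (W j)) (t, x).
  transitivity (\sum_j dt (dx j (W j)) (t, x)).
    exact: (dsum _ (fun j => dx j (W j)) (fun j => smooth_dx j (sW j)) _ Utx).
  by apply: eq_bigr => j _; exact: (schwarz _ _ oU (sW j) Utx).
have dd k : dx k (dx k divergence) (t, x) = \sum_j dx k (dx k (dx j (W j))) (t, x).
  transitivity (dx k (fun p => \sum_j dx k (dx j (W j)) p) (t, x)).
    apply: near_eq_derive; apply: filterS nU => p Up.
    exact: (dsum _ (fun j => dx j (W j)) (fun j => smooth_dx j (sW j)) _ Up).
  exact: (dsum _ (fun j => dx k (dx j (W j)))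
    (fun j => smooth_dx k (smooth_dx j (sW j))) _ Utx).
have dl j : dx j (laplacian (W j)) (t, x) = \sum_k dx k (dx k (dx j (W j))) (t, x).
  transitivity (\sum_k dx j (dx k (dx k (W j))) (t, x)).
    exact: (dsum _ (fun k => dx k (dx k (W j)))
      (fun k => smooth_dx k (smooth_dx k (sW j))) _ Utx).
  apply: eq_bigr => k _; transitivity (dx k (dx j (dx k (W j))) (t, x)).
    exact: (schwarz _ _ oU (smooth_dx k (sW j)) Utx).
  apply: near_eq_derive; apply: filterS nU => p Up.
  exact: (schwarz _ _ oU (sW j) Up).
rewrite dt_div pois; congr (_ * _).
rewrite (eq_bigr _ (fun j _ => dl j)) exchange_big /=.
by rewrite /laplacian; apply: eq_bigr => k _; exact: esym (dd k).
Qed.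

Let div_w t x : t0 <= t <= T -> Om x -> divergence (t, x) = 0.
Proof.
apply: (heat_zero oU smooth_divergence nu0 cU divergence_heat).
  move=> s y sI cly r0; have by_ : bdry Om y by exact/bdryE.
  by rewrite -(proj2 (bdry_w sI by_)) (div_coordf sW)//; exact: cU.
(* At time [t0] the field [w] equals [u], which is divergence free as a projection. *)
move=> y Oy; rewrite -(div_u t0I Oy) /divergence; apply: eq_bigr => j _.
rewrite -(pd_slice (W j)) -(pd_slice (Uc j)); apply: near_eq_derive.
apply: filterS (Om_near Oy) => z Oz.
by rewrite /coordf /= initial//; exact: subset_closure.
Qed.

(** At a fixed boundary point the Neumann condition cancels the force, advection and viscous terms
    of the momentum equation together, leaving [- lambda] times the normal part of [w]. The initial
    value is zero because [w = u] at [t0] and [u . n = 0]. *)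
Let normal_w t x : t0 <= t <= T -> closure Om x -> rho x = 0 ->
  \sum_j pd j rho x * W j (t, x) = 0.
Proof.
move=> tI clx r0; have bx : bdry Om x by exact/bdryE.
move: t tI.
apply: (@ode_zero _ (fun s => \sum_j pd j rho x * W j (s, x)) lambda _ _ lambda0).
  move=> s sI; have Usx := cU sI clx.
  have h j := is_derive_time (smooth_derivable (v := ((1, 0) : X)) (sW j) Usx).
  have hc j := is_deriveZ (pd j rho x) (h j).
  have [dE dD] := @derive_sumE _ _ _ (index_enum 'I_D)
    (fun j s => pd j rho x * W j (s, x)) s 1
    (fun j => ex_derive (is_derive := hc j)).
  split; first exact: dD.
  rewrite [LHS]dE (eq_bigr (fun j => pd j rho x * rhs j (s, x))) => [|j _]; last first.
    by rewrite (derive_val (is_derive := hc j)) -momentum_closure.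
  have [c c0 nd] := normal_dot r0.
  have := bdry_q sI bx; rewrite !nd mulrCA -mulrDr => /(mulfI c0) bq.
  have {}bq : \sum_j pd j rho x * dx j Q (s, x) =
      \sum_j pd j rho x * (G j (s, x) - advection j (s, x) +
         nu * laplacian (W j) (s, x)) + lambda * \sum_j pd j rho x * W j (s, x).
    rewrite -[in X in _ + X]/(\sum_j pd j rho x * w s x 0 j).
    transitivity (\sum_j pd j rho x * grad (q s) x 0 j).
      by apply: eq_bigr => j _; rewrite grad_q.
    rewrite bq; congr (_ + _); apply: eq_bigr => j _.
    by rewrite !mxE adv_coordf// lap_coordf.
  rewrite (_ : \sum_j pd j rho x * rhs j (s, x) =
    \sum_j pd j rho x * (G j (s, x) - advection j (s, x) +
         nu * laplacian (W j) (s, x)) - \sum_j pd j rho x * dx j Q (s, x)).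
    by rewrite bq opprD addrA subrr add0r.
  by rewrite -sumrB; apply: eq_bigr => j _; rewrite /rhs; ring.
have [c c0 nd] := normal_dot r0.
have := bdry_u t0I bx; rewrite dotC nd => /eqP; rewrite mulf_eq0 (negbTE c0)/=.
move=> /eqP h; rewrite -[RHS]h; apply: eq_bigr => j _.
by rewrite /coordf /= initial.
Qed.
(** Argued at each time separately, since the potential [phi] comes without any dependence on time;
    the equality in [Om] then extends to the closure. *)
Let w_eq_u t x i : t0 <= t <= T -> closure Om x -> Uc i (t, x) = W i (t, x).
Proof.
move=> tI; apply: (eq_closure (f := fun x => Uc i (t, x))
  (g := fun x => W i (t, x))) x => [x clx|x clx|x Ox].
- exact: (smooth_cont (smooth_slice t (sU i)) (cU tI clx)).
- exact: (smooth_cont (smooth_slice t (sW i)) (cU tI clx)).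
have [phi [[V [oV cV sp]] lp np up]] := projection tI.
have pd0 y j : Om y -> pd j phi y = 0.
  apply: (neumann_zero oV cV sp) => {y j}[y Oy|y cly r0].
    rewrite -[LHS]/(lap phi y) lp// (div_coordf sW (UO tI Oy)).
    exact: div_w.
  have [c c0 nd] := normal_dot r0.
  have by_ : bdry Om y by exact/bdryE.
  have := np y by_; rewrite !nd => /(mulfI c0) e.
  rewrite -[RHS](normal_w tI cly r0) -[RHS]e.
  by apply: eq_bigr => j _; rewrite mxE mulrC.
by rewrite /coordf /= up// !mxE pd0// subr0.
Qed.

Let no_slip t x i : t0 <= t <= T -> closure Om x -> rho x = 0 -> Uc i (t, x) = 0.
Proof.
move=> tI clx r0; rewrite w_eq_u//.
have bx : bdry Om x by exact/bdryE.
have [c c0 nd] := normal_dot r0.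
have wn : dot (w t x) (normal rho x) = 0.
  by rewrite dotC nd -[RHS](mulr0 c); congr (_ * _); exact: normal_w.
(* Having no normal component, [w] is itself a tangent vector and may be tested against itself. *)
have ww := proj1 (bdry_w tI bx) _ wn.
exact: (@sum_sqr_eq0 (fun j => w t x 0 j) ww).
Qed.

(** The time is strictly inside the interval: [u = w] must hold on both sides of [t] for the time
    derivatives to agree. *)
Let velocity_eq t x i : t0 < t < T -> Om x ->
  dt (Uc i) (t, x) = G i (t, x) - advection i (t, x) - dx i Q (t, x) +
    nu * laplacian (Uc i) (t, x).
Proof.
move=> /andP[t0t tT] Ox; have tI : t0 <= t <= T by rewrite !ltW.
have Utx := UO tI Ox; have clx := subset_closure Ox.
have hU := is_derive_time (smooth_derivable (v := ((1, 0) : X)) (sU i) Utx).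
have hW := is_derive_time (smooth_derivable (v := ((1, 0) : X)) (sW i) Utx).
have -> : dt (Uc i) (t, x) = dt (W i) (t, x).
  rewrite -(derive_val (is_derive := hU)) -(derive_val (is_derive := hW)).
  apply: near_eq_derive.
  have n1 : \forall s \near t, t0 < s by exact: lt_nbhsr.
  have n2 : \forall s \near t, s < T by exact: lt_nbhsl.
  by apply: filterS2 n1 n2 => s s0 sT; apply: w_eq_u => //; rewrite !ltW.
rewrite (momentum_coord i tI Ox).
have dxE j y : Om y -> dx j (Uc i) (t, y) = dx j (W i) (t, y).
  move=> Oy; apply: dx_eq_near; apply: filterS (Om_near Oy) => z Oz.
  exact: (w_eq_u i tI (subset_closure Oz)).
have lapE : laplacian (Uc i) (t, x) = laplacian (W i) (t, x).
  by apply: eq_bigr => j _; apply: dx_eq_near; apply: filterS (Om_near Ox) => z /dxE.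
rewrite lapE /rhs; ring.
Qed.

(** * The energy balance *)

Lemma kinetic_energy t : t0 < t < T ->
  is_derive t 1 (fun s => 2^-1 * J (fun x => dot (u s x) (u s x)))
    (- nu * J (fun x =>
       \sum_(i < D) \sum_(j < D) pd j (fun y => u t y 0 i) x ^+ 2)).
Proof.
move=> tI'; have tI : t0 <= t <= T by move: tI' => /andP[? ?]; rewrite !ltW.
pose e2 (p : X) := \sum_i Uc i p * Uc i p.
have se2 : smooth_on U e2 by apply: smooth_sum => // i; apply: smoothM.
have dJ := J_derive_smooth oU se2 (fun x => cU tI (x := x)).
apply: (is_derive_eq (is_deriveZ 2^-1 dJ)).
pose ui i (x : 'rV[R]_D) := Uc i (t, x).
have cV := cUt tI.
have sui i : smooth_on (tslice U t) (ui i) by exact: smooth_slice (sU i).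
have bui i x : closure Om x -> rho x = 0 -> ui i x = 0 by exact: no_slip.
have pdui i j x : pd j (ui i) x = dx j (Uc i) (t, x) by exact: (pd_slice (Uc i)).
have pd2ui i j x : pd j (pd j (ui i)) x = dx j (dx j (Uc i)) (t, x).
  by exact: pd2_coordf.
have dui x : Om x -> \sum_j pd j (ui j) x = 0.
  move=> Ox; rewrite -[RHS](div_u tI Ox); apply: eq_bigr => j _; exact: pdui.
have nG i : bdd_cont (fun x => G i (t, x)) by exact: smooth_bdd cV (smooth_slice t (sG i)).
have nui i := smooth_bdd cV (sui i).
have ndui i j := smooth_bdd cV (smooth_derive (ev R j) (sui i)).
have nddui i j := smooth_bdd cV (smooth_derive (ev R j) (smooth_derive (ev R j) (sui i))).
have gradE j x : Om x -> pd j (varphi t) x = - G j (t, x).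
  move=> Ox; have [_ gE] := conservative tI Ox.
  by rewrite /coordf /= gE !mxE opprK.
(* The derivative of [varphi] in any direction is a combination of components of [- g], which are
   bounded since [g] is smooth up to the boundary. *)
have nphi : bdd_cont (varphi t).
  apply: grad_bounded_bdd_cont => [x Ox|v].
    by have [] := conservative tI Ox.
  have [_ [C hC]] : bdd_cont (fun x => \sum_j v 0 j * - G j (t, x)).
    apply: bdd_cont_sum => j; apply: bdd_contZ.
    by apply: bdd_cont_ext (bdd_contZ (-1) (nG j)) => x _; rewrite mulN1r.
  exists C => x Ox; have [dphi _] := conservative tI Ox.
  rewrite derive_dir// (eq_bigr (fun j => v 0 j * - G j (t, x))) ?hC// => j _.
  by rewrite gradE.
have intG : J (fun x => \sum_i ui i x * G i (t, x)) = 0.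
  have ndphi j : bdd_cont (pd j (varphi t)).
    apply: bdd_cont_ext (bdd_contZ (-1) (nG j)) => x Ox.
    by rewrite gradE// mulN1r.
  have h := J_grad cV sui bui dui nphi _ ndphi.
  have n1 : bdd_cont (fun x => \sum_i ui i x * G i (t, x)).
    by apply: bdd_cont_sum => i; exact: bdd_contM.
  apply: oppr_inj; rewrite oppr0 -J_N// -[RHS]h.
    apply: J_ext => x Ox; rewrite -sumrN; apply: eq_bigr => i _.
    by rewrite gradE// mulrN.
  by move=> x j Ox; apply: diff_derivable; have [] := conservative tI Ox.
have sqt : smooth_on (tslice U t) (fun x => Q (t, x)) by exact: smooth_slice sQ.
have intQ : J (fun x => \sum_i ui i x * dx i Q (t, x)) = 0.
  rewrite -[RHS](J_grad cV sui bui dui (smooth_bdd cV sqt) _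
    (fun j => smooth_bdd cV (smooth_derive (ev R j) sqt))).
    by apply: J_ext => x _; apply: eq_bigr => j _; rewrite -(pd_slice Q).
  by move=> x j /subset_closure/cV Vx; exact: smooth_derivable sqt Vx.
have nQ i : bdd_cont (fun x => dx i Q (t, x)).
  exact: smooth_bdd cV (smooth_slice t (smooth_dx i sQ)).
have nadv i : bdd_cont (fun x => \sum_j ui j x * pd j (ui i) x).
  by apply: bdd_cont_sum => j; exact: (bdd_contM (nui j) (ndui i j)).
have nlap i : bdd_cont (fun x => \sum_j pd j (pd j (ui i)) x).
  by apply: bdd_cont_sum => j; exact: nddui.
have nsq i : bdd_cont (fun x => \sum_j pd j (ui i) x ^+ 2).
  by apply: bdd_cont_sum => j; exact: (bdd_contM (ndui i j) (ndui i j)).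
have n1 : bdd_cont (fun x => \sum_i ui i x * G i (t, x)).
  by apply: bdd_cont_sum => i; exact: (bdd_contM (nui i) (nG i)).
have n2 i : bdd_cont (fun x => ui i x * \sum_j ui j x * pd j (ui i) x)
  by exact: (bdd_contM (nui i) (nadv i)).
have n3 : bdd_cont (fun x => \sum_i ui i x * dx i Q (t, x)).
  by apply: bdd_cont_sum => i; exact: (bdd_contM (nui i) (nQ i)).
have n4 i : bdd_cont (fun x => ui i x * \sum_j pd j (pd j (ui i)) x)
  by exact: (bdd_contM (nui i) (nlap i)).
(* The velocity equation multiplied by [2 u], grouped into the force, advection, pressure and
   viscous terms, which are then integrated one by one. *)
have -> : J (fun x => dt e2 (t, x)) = J (fun x =>
    2 * ((\sum_i ui i x * G i (t, x)) +
      ((-1) * (\sum_i ui i x * \sum_j ui j x * pd j (ui i) x) +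
      ((-1) * (\sum_i ui i x * dx i Q (t, x)) +
       nu * \sum_i ui i x * \sum_j pd j (pd j (ui i)) x)))).
  apply: J_ext => x Ox; have Utx := UO tI Ox.
  have dU i := smooth_derivable (v := ((1, 0) : X)) (sU i) Utx.
  have dUU i := is_deriveM (derivableP (dU i)) (derivableP (dU i)).
  have [+ _] := @derive_sumE _ _ _ (index_enum 'I_D) (fun i p => Uc i p * Uc i p)
    (t, x) ((1, 0) : X) (fun i => ex_derive (is_derive := dUU i)).
  move=> h; rewrite [LHS]h !mulr_sumr -!big_split/= mulr_sumr.
  apply: eq_bigr => i _; rewrite (derive_val (is_derive := dUU i)).
  rewrite -/(dt (Uc i) (t, x)) velocity_eq//.
  have -> : \sum_j ui j x * pd j (ui i) x = advection i (t, x).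
    by apply: eq_bigr => j _; rewrite pdui.
  have -> : \sum_j pd j (pd j (ui i)) x = laplacian (Uc i) (t, x).
    by apply: eq_bigr => j _; exact: pd2ui.
  by rewrite /GRing.scale/= /ui; ring.
have m4 : bdd_cont (fun x => nu * \sum_i ui i x * \sum_j pd j (pd j (ui i)) x).
  by apply: bdd_contZ; exact: bdd_cont_sum.
have m3 : bdd_cont (fun x => (-1) * (\sum_i ui i x * dx i Q (t, x))) by exact: bdd_contZ.
have m2 : bdd_cont (fun x => (-1) * (\sum_i ui i x * \sum_j ui j x * pd j (ui i) x)).
  by apply: bdd_contZ; exact: bdd_cont_sum.
rewrite J_Z; last by do ! apply: bdd_contD.
rewrite J_D; [|exact: n1|by do ! apply: bdd_contD].
rewrite J_D; [|exact: m2|by do ! apply: bdd_contD].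
rewrite J_D; [|exact: m3|exact: m4].
rewrite intG (J_Z (-1) (bdd_cont_sum (index_enum 'I_D) n2)) (J_Z (-1) n3).
rewrite (J_Z nu (bdd_cont_sum (index_enum 'I_D) n4)).
rewrite intQ (J_sum _ n2) (J_sum _ n4).
rewrite [X in -1 * X]big1 => [|i _]; last exact: (J_adv cV sui bui dui).
rewrite (eq_bigr _ (fun i _ => J_lap cV sui bui i)) sumrN -(J_sum _ nsq).
have fin (K : R) : 2^-1 * (2 * (0 + (-1 * 0 + (-1 * 0 + nu * - K)))) = - nu * K.
  by field.
exact: fin.
Qed.
End Solution.

End Domain.

Theorem theorem7 (R : realType) (D : nat) (nu lambda : R)
  (Omega : set 'rV[R]_D) (rho : 'rV[R]_D -> R)
  (t0 T : R) (U : set (R * 'rV[R]_D))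
  (g w u : R -> 'rV[R]_D -> 'rV[R]_D) (q varphi : R -> 'rV[R]_D -> R) :
  0 < nu -> 0 <= lambda -> t0 < T ->
  smooth_bounded_domain Omega rho ->
  (* "sufficiently smooth": all fields are C^infty in (t, x) on an open set
     containing [t0, T] x closure(Omega) *)
  open U ->
  (forall t x, t0 <= t <= T -> closure Omega x -> U (t, x)) ->
  (forall i : 'I_D,
     [/\ smooth_on U (fun p => w p.1 p.2 0 i),
         smooth_on U (fun p => u p.1 p.2 0 i) &
         smooth_on U (fun p => g p.1 p.2 0 i)]) ->
  smooth_on U (fun p => q p.1 p.2) ->
  (* conservative body force g = - grad varphi in Omega *)
  (forall t x, t0 <= t <= T -> Omega x ->
     differentiable (varphi t) x /\ g t x = - grad (varphi t) x) ->
  (* momentum equation *)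
  (forall t x, t0 <= t <= T -> Omega x ->
     'D_1 (fun s => w s x) t
       = g t x - adv (u t) x - grad (q t) x + nu *: lap (w t) x) ->
  (* boundary conditions for w *)
  (forall t x, t0 <= t <= T -> bdry Omega x ->
     (forall tau : 'rV[R]_D, dot tau (normal rho x) = 0 -> dot (w t x) tau = 0)
     /\ div (w t) x = 0) ->
  (* u = P w (Leray-Helmholtz projection) in Omega *)
  (forall t, t0 <= t <= T ->
     exists phi : 'rV[R]_D -> R,
       [/\ exists V : set 'rV[R]_D,
             [/\ open V, closure Omega `<=` V & smooth_on V phi],
           (forall x, Omega x -> lap phi x = div (w t) x),
           (forall x, bdry Omega x ->
              dot (normal rho x) (grad phi x) = dot (normal rho x) (w t x)) &
           (forall x, Omega x -> u t x = w t x - grad phi x)]) ->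
  (* u . n = 0 on the boundary *)
  (forall t x, t0 <= t <= T -> bdry Omega x -> dot (u t x) (normal rho x) = 0) ->
  (* pressure Poisson equation and its Neumann condition *)
  (forall t x, t0 <= t <= T -> Omega x ->
     lap (q t) x = div (fun y => g t y - adv (u t) y) x) ->
  (forall t x, t0 <= t <= T -> bdry Omega x ->
     dot (normal rho x) (grad (q t) x)
       = dot (normal rho x) (g t x - adv (u t) x + nu *: lap (w t) x)
         + lambda * dot (normal rho x) (w t x)) ->
  (* initial condition *)
  (forall x, closure Omega x -> w t0 x = u t0 x) ->
  (* energy identity *)
  forall t, t0 < t < T ->
    is_derive t 1
      (fun s => 2^-1 * intOmega Omega (fun x => dot (u s x) (u s x)))
      (- nu * intOmega Omega (fun x =>
          \sum_(i < D) \sum_(j < D) (pd j (fun y => u t y 0 i) x) ^+ 2)).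
Proof.
move=> nu0 lam0 t0T [oO [B [_ hB]] _ [srho OE grho]] oU cU sf sQ cons mom bw proj
  bu pois bq init t tI.
have M0 : 0 <= `|B| + 1 by rewrite addr_ge0.
have OmM x : Omega x -> `|x| <= `|B| + 1.
  by apply: hB; rewrite ltr_pwDr// ler_norm.
have drho x : differentiable rho x by exact: smooth_diff srho _.
have crho : continuous rho by move=> x; exact/differentiable_continuous/drho.
have cdrho v x : {for x, continuous (fun y => 'D_v rho y)}.
  exact: (smooth_cont (smooth_derive v srho)).
apply: (kinetic_energy OE oO M0 OmM crho drho cdrho grho srho (ltW nu0) lam0 t0T oU
  cU _ _ _ sQ cons mom bw proj bu pois bq init tI).
- by move=> i; have [] := sf i.
- by move=> i; have [] := sf i.
- by move=> i; have [] := sf i.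
Qed.
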